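(* Let $G$ be a group acting properly, cocompactly and freely on a finite-dimensional AR $X_1$ and on an AR $X_2$. Assume that $X_1$ and $X_2$ are $G$-equivariantly homotopy equivalent and that $(\hat{X}_2,Z)$, with $\hat{X}_2=X_2\cup Z$, is an AR $\mathscr{Z}$-structure on $G$. Then there is a compactification $\hat{X}_1=X_1\cup Z$ of $X_1$ with remainder $Z$ such that $(\hat{X}_1,Z)$ is a $\mathscr{Z}$-structure on $G$.
   Context: All spaces are locally compact, separable and metrizable. A separable metric space is an AR if whenever it is embedded as a closed subset of another separable metric space, its image is a retract of that space; it is an ANR if some neighborhood of the image retracts onto it; an ER is a finite-dimensional AR. A closed subset $A$ of an ANR $Y$ is a $\mathscr{Z}$-set if there is a homotopy $H:Y\times[0,1]\to Y$ with $H_0=\mathrm{id}_Y$ and $H_t(Y)\subset Y-A$ for all $t>0$; a $\mathscr{Z}$-compactification of $Y$ is a compactification $\hat{Y}$ with $\hat{Y}-Y$ a $\mathscr{Z}$-set in $\hat{Y}$. A $\mathscr{Z}$-structure on a group $G$ is a pair $(\hat{X},Z)$ such that: (1) $\hat{X}$ is a compact ER; (2) $\hat{X}$ is a $\mathscr{Z}$-compactification of $X=\hat{X}-Z$; (3) $G$ acts properly, cocompactly and freely on $X$; (4) (nullity condition) for every compact $C\subseteq X$ and every open cover $\mathscr{U}$ of $\hat{X}$, all but finitely many $G$-translates of $C$ lie in a single element of $\mathscr{U}$. An AR $\mathscr{Z}$-structure on $G$ is a pair satisfying the same conditions except that in (1) $\hat{X}$ is only required to be a compact AR. *)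

(* Defs.v *)
From Stdlib Require Import Reals List ProofIrrelevance.
Open Scope R_scope.

(* ---------- metric spaces (all spaces in the paper are metrizable) ---------- *)
Record MetricSpace := {
  mcar :> Type;
  dist : mcar -> mcar -> R;
  dist_refl : forall x, dist x x = 0;
  dist_eq : forall x y, dist x y = 0 -> x = y;
  dist_sym : forall x y, dist x y = dist y x;
  dist_tri : forall x y z, dist x z <= dist x y + dist y z
}.
Arguments dist {m} _ _.

Definition subspace (X : MetricSpace) (P : X -> Prop) : MetricSpace.
Proof.
  refine {| mcar := {x : X | P x};
            dist := fun x y => dist (proj1_sig x) (proj1_sig y) |}.
  - intros [x px]; apply dist_refl.
  - intros [x px] [y py] H; simpl in H. apply dist_eq in H. subst y.
    f_equal; apply proof_irrelevance.
  - intros x y; apply dist_sym.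
  - intros x y z; apply dist_tri.
Defined.

Definition compl {X : Type} (A : X -> Prop) : X -> Prop := fun x => ~ A x.

Definition continuous {X Y : MetricSpace} (f : X -> Y) : Prop :=
  forall x eps, 0 < eps -> exists delta, 0 < delta /\
    forall y, dist x y < delta -> dist (f x) (f y) < eps.

Definition is_open {X : MetricSpace} (U : X -> Prop) : Prop :=
  forall x, U x -> exists r, 0 < r /\ forall y, dist x y < r -> U y.

Definition is_closed {X : MetricSpace} (C : X -> Prop) : Prop := is_open (compl C).

Definition dense {X : MetricSpace} (D : X -> Prop) : Prop :=
  forall x r, 0 < r -> exists y, D y /\ dist x y < r.

Definition separable (X : MetricSpace) : Prop :=
  exists s : nat -> X, dense (fun y => exists n, s n = y).

Definition compact_set {X : MetricSpace} (K : X -> Prop) : Prop :=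
  forall (I : Type) (U : I -> X -> Prop),
    (forall i, is_open (U i)) -> (forall x, K x -> exists i, U i x) ->
    exists l : list I, forall x, K x -> exists i, In i l /\ U i x.

Definition compact_space (X : MetricSpace) : Prop := compact_set (fun _ : X => True).

Definition locally_compact (X : MetricSpace) : Prop :=
  forall x : X, exists (K : X -> Prop) r, compact_set K /\ 0 < r /\
    forall y, dist x y < r -> K y.

Definition homeomorphism {X Y : MetricSpace} (f : X -> Y) : Prop :=
  exists g : Y -> X, continuous f /\ continuous g /\
    (forall x, g (f x) = x) /\ (forall y, f (g y) = y).

Definition homeomorphic (X Y : MetricSpace) : Prop :=
  exists f : X -> Y, homeomorphism f.

Definition closed_embedding {X Y : MetricSpace} (j : X -> Y) : Prop :=
  continuous j /\ (forall x x', j x = j x' -> x = x') /\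
  (forall x eps, 0 < eps -> exists delta, 0 < delta /\
     forall x', dist (j x) (j x') < delta -> dist x x' < eps) /\
  is_closed (fun y => exists x, j x = y).

Definition AR (X : MetricSpace) : Prop :=
  separable X /\
  forall (Y : MetricSpace), separable Y -> forall j : X -> Y, closed_embedding j ->
    exists r : Y -> X, continuous r /\ forall x, r (j x) = x.

(* covering dimension <= n (finite open covers, refinements of order <= n+1) *)
Definition dim_le (X : MetricSpace) (n : nat) : Prop :=
  forall U : list (X -> Prop),
    (forall V, In V U -> is_open V) -> (forall x, exists V, In V U /\ V x) ->
    exists W : list (X -> Prop),
      (forall V, In V W -> is_open V) /\ (forall x, exists V, In V W /\ V x) /\
      (forall V, In V W -> exists U0, In U0 U /\ forall x, V x -> U0 x) /\
      (forall x (idx : list nat), NoDup idx -> length idx = (n + 2)%nat ->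
         (forall i, In i idx -> (i < length W)%nat) ->
         exists i, In i idx /\ ~ (nth i W (fun _ => False)) x).

Definition finite_dim (X : MetricSpace) : Prop := exists n, dim_le X n.

Definition ER (X : MetricSpace) : Prop := AR X /\ finite_dim X.

Definition htpy_continuous {X Y : MetricSpace} (H : X -> R -> Y) : Prop :=
  forall x t, 0 <= t <= 1 -> forall eps, 0 < eps -> exists delta, 0 < delta /\
    forall x' t', 0 <= t' <= 1 -> dist x x' < delta -> Rabs (t - t') < delta ->
      dist (H x t) (H x' t') < eps.

Definition Zset {Y : MetricSpace} (A : Y -> Prop) : Prop :=
  is_closed A /\
  exists H : Y -> R -> Y, htpy_continuous H /\ (forall y, H y 0 = y) /\
    (forall y t, 0 < t <= 1 -> ~ A (H y t)).

Record Group := {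
  gcar :> Type;
  gmul : gcar -> gcar -> gcar;
  gone : gcar;
  ginv : gcar -> gcar;
  gassoc : forall a b c, gmul a (gmul b c) = gmul (gmul a b) c;
  gone_l : forall a, gmul gone a = a;
  ginv_l : forall a, gmul (ginv a) a = gone
}.
Arguments gmul {g} _ _.
Arguments gone {g}.
Arguments ginv {g} _.

Definition is_action {G : Group} {X : MetricSpace} (a : G -> X -> X) : Prop :=
  (forall x, a gone x = x) /\ (forall g h x, a (gmul g h) x = a g (a h x)) /\
  (forall g, continuous (a g)).

Definition proper_action {G : Group} {X : MetricSpace} (a : G -> X -> X) : Prop :=
  forall K : X -> Prop, compact_set K ->
    exists l : list G, forall g, (exists x, K x /\ K (a g x)) -> In g l.

Definition cocompact_action {G : Group} {X : MetricSpace} (a : G -> X -> X) : Prop :=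
  exists K : X -> Prop, compact_set K /\ forall x, exists g y, K y /\ a g y = x.

Definition free_action {G : Group} {X : MetricSpace} (a : G -> X -> X) : Prop :=
  forall g x, a g x = x -> g = gone.

Definition nullity {G : Group} {Xh : MetricSpace} (Z : Xh -> Prop)
    (a : G -> subspace Xh (compl Z) -> subspace Xh (compl Z)) : Prop :=
  forall C : subspace Xh (compl Z) -> Prop, compact_set C ->
  forall (I : Type) (U : I -> Xh -> Prop),
    (forall i, is_open (U i)) -> (forall x, exists i, U i x) ->
    exists l : list G, forall g, ~ In g l ->
      exists i, forall x, C x -> U i (proj1_sig (a g x)).

Definition ZStructure_common {G : Group} (Xh : MetricSpace) (Z : Xh -> Prop)
    (a : G -> subspace Xh (compl Z) -> subspace Xh (compl Z)) : Prop :=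
  compact_space Xh /\ is_closed Z /\ dense (compl Z) /\ Zset Z /\
  is_action a /\ proper_action a /\ cocompact_action a /\ free_action a /\
  nullity Z a.

Definition ZStructure {G : Group} (Xh : MetricSpace) (Z : Xh -> Prop)
    (a : G -> subspace Xh (compl Z) -> subspace Xh (compl Z)) : Prop :=
  ER Xh /\ ZStructure_common Xh Z a.

Definition AR_ZStructure {G : Group} (Xh : MetricSpace) (Z : Xh -> Prop)
    (a : G -> subspace Xh (compl Z) -> subspace Xh (compl Z)) : Prop :=
  AR Xh /\ ZStructure_common Xh Z a.

Definition equivariant {G : Group} {X Y : MetricSpace}
    (a : G -> X -> X) (b : G -> Y -> Y) (f : X -> Y) : Prop :=
  forall g x, f (a g x) = b g (f x).

Definition equiv_homotopic {G : Group} {X Y : MetricSpace}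
    (a : G -> X -> X) (b : G -> Y -> Y) (f0 f1 : X -> Y) : Prop :=
  exists H : X -> R -> Y, htpy_continuous H /\
    (forall x, H x 0 = f0 x) /\ (forall x, H x 1 = f1 x) /\
    (forall t, 0 <= t <= 1 -> equivariant a b (fun x => H x t)).

Definition equiv_htpy_equivalent {G : Group} {X Y : MetricSpace}
    (a : G -> X -> X) (b : G -> Y -> Y) : Prop :=
  exists (f : X -> Y) (g : Y -> X),
    continuous f /\ continuous g /\ equivariant a b f /\ equivariant b a g /\
    equiv_homotopic a a (fun x => g (f x)) (fun x => x) /\
    equiv_homotopic b b (fun y => f (g y)) (fun y => y).

(* Main.v *)
From Stdlib Require Import Reals List Lra Lia Classical ClassicalEpsilon
  FunctionalExtensionality ProofIrrelevance Cantor.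
Require Import Defs.

(** Let [f : X1 -> X2] and [k : X2 -> X1] be the equivariant maps, [J] the homotopy from [k f]
    to the identity, and [h] the homotopy pushing [X2 ∪ Z] off [Z]. The space [X1 ∪ Z] carries
    the coarsest topology that keeps [X1] as an open subspace and makes [f], extended by the
    identity of [Z], continuous; it is compact because [f] is proper. By the nullity condition, equivariant maps
    that agree up to a bounded amount agree in the limit at [Z], so [k] and [J] extend by the
    identity of [Z]. Points deep inside [X1] are left fixed, points near [Z] are moved by
    [k h_t f], and [J] interpolates: this pushes [X1 ∪ Z] off [Z] instantly. Pulling covers of
    [X1] back along a small push bounds the dimension of [X1 ∪ Z]. For a closed embedding of
    [X1 ∪ Z] in [Y], the push, seen as a map to the absolute extensor [X1] defined on
    [(X1 ∪ Z) × (0, 1]], extends to [Y × (0, 1]]; restricting the extension to the graph of a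
    function that tends to [0] slowly enough at [X1 ∪ Z] gives a retraction. *)

(** * Truncated suprema and distances to sets *)

(** Two obstacles shape the proof. First, [AR] speaks of closed embeddings only, while the
    retraction needs maps into [X1] to extend from closed subsets; embedding the compactification in
    a cube of functions turns the one into the other. Second, off the compactification the extended
    push is uncontrolled as [t] tends to [0]. For [t] bounded away from [0] it is controlled near
    the compactification, by compactness, and [tau] selects, for each small distance, a small time
    at which the control still holds.

    The control at infinity has a single source: two equivariant maps on a cocompact space stay, up
    to translation, within one compact set, and all but finitely many translates of that set are
    small. The metric of [X1 ∪ Z] contains the distance of the images in [X2 ∪ Z] as a summand, so
    that estimates near [Z] take place there. *)

Lemma csup_ex (E : R -> Prop) :
  {m | is_lub (fun x => x = 0 \/ (E x /\ x <= 1)) m}.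
Proof.
  apply completeness.
  - exists 1. intros x [-> | [_ H]]; lra.
  - exists 0. now left.
Qed.

(* The supremum of [{0}] and the elements of [E] that are at most [1]: it is always defined. *)
Definition csup (E : R -> Prop) : R := proj1_sig (csup_ex E).

Lemma csup_ge (E : R -> Prop) (x : R) : E x -> x <= 1 -> x <= csup E.
Proof. intros Hx H1. apply (proj2_sig (csup_ex E)). now right. Qed.

Lemma csup_le (E : R -> Prop) (b : R) :
  0 <= b -> (forall x, E x -> x <= 1 -> x <= b) -> csup E <= b.
Proof.
  intros Hb H. apply (proj2_sig (csup_ex E)). intros x [-> | [Hx H1]]; auto.
Qed.

Lemma csup_nonneg (E : R -> Prop) : 0 <= csup E.
Proof. apply (proj2_sig (csup_ex E)). now left. Qed.

Lemma csup_le1 (E : R -> Prop) : csup E <= 1.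
Proof. apply csup_le; [lra | auto]. Qed.

Lemma csup_lt (E : R -> Prop) (x : R) :
  0 <= x -> x < csup E -> exists r, E r /\ r <= 1 /\ x < r.
Proof.
  intros H0 Hx. apply NNPP. intros Hn.
  assert (csup E <= x); [|lra].
  apply csup_le; auto. intros r Hr Hr1.
  destruct (Rle_or_lt r x) as [|Hlt]; auto. exfalso; apply Hn; eauto.
Qed.

Lemma dist_nonneg (X : MetricSpace) (x y : X) : 0 <= dist x y.
Proof.
  pose proof (dist_tri X x y x) as H. rewrite dist_refl, (dist_sym X y x) in H. lra.
Qed.

Lemma subspace_eq {X : MetricSpace} {P : X -> Prop} (p q : subspace X P) :
  proj1_sig p = proj1_sig q -> p = q.
Proof.
  destruct p as [x hx], q as [y hy]; simpl. intros ->. f_equal. apply proof_irrelevance.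
Qed.

(* This is [min 1 (inf_{z in A} d(x, z))]; in particular it equals [1] when [A] is empty. *)
Definition dset {X : MetricSpace} (A : X -> Prop) (x : X) : R :=
  csup (fun r => forall z, A z -> r <= dist x z).

Lemma dset_nonneg {X : MetricSpace} (A : X -> Prop) (x : X) : 0 <= dset A x.
Proof. apply csup_nonneg. Qed.

Lemma dset_le1 {X : MetricSpace} (A : X -> Prop) (x : X) : dset A x <= 1.
Proof. apply csup_le1. Qed.

Lemma dset_le {X : MetricSpace} (A : X -> Prop) (x z : X) : A z -> dset A x <= dist x z.
Proof. intros Hz. apply csup_le; [apply dist_nonneg | auto]. Qed.

Lemma dset_in {X : MetricSpace} (A : X -> Prop) (x : X) : A x -> dset A x = 0.
Proof.
  intros Hx. pose proof (dset_le A x x Hx). rewrite dist_refl in *.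
  pose proof (dset_nonneg A x). lra.
Qed.

Lemma dset_lip {X : MetricSpace} (A : X -> Prop) (x y : X) :
  dset A x <= dset A y + dist x y.
Proof.
  pose proof (dist_nonneg X x y). pose proof (dset_nonneg A y).
  apply csup_le; [lra|]. intros r Hr H1.
  assert (r - dist x y <= dset A y); [|lra].
  apply csup_ge; [|lra]. intros z Hz. specialize (Hr z Hz).
  pose proof (dist_tri X x y z). lra.
Qed.

Lemma dset_abs {X : MetricSpace} (A : X -> Prop) (x y : X) :
  Rabs (dset A x - dset A y) <= dist x y.
Proof.
  pose proof (dset_lip A x y). pose proof (dset_lip A y x).
  rewrite (dist_sym X y x) in *. apply Rabs_le. lra.
Qed.

Lemma dset_pos {X : MetricSpace} (A : X -> Prop) (x : X) :
  is_closed A -> ~ A x -> 0 < dset A x.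
Proof.
  intros HA Hx. destruct (HA x Hx) as [r [Hr H]].
  assert (Rmin r 1 <= dset A x).
  - apply csup_ge; [|apply Rmin_r]. intros z Hz.
    destruct (Rle_or_lt (Rmin r 1) (dist x z)) as [|Hlt]; auto.
    exfalso. apply (H z); auto. pose proof (Rmin_l r 1); lra.
  - pose proof (Rmin_glb_lt r 1 0 Hr Rlt_0_1). lra.
Qed.

(** At the value [1] the truncation hides whether [A] has any point nearby, or any point at all;
    hence the strict bound. *)
Lemma dset_near {X : MetricSpace} (A : X -> Prop) (x : X) (e : R) :
  dset A x < 1 -> 0 < e -> exists z, A z /\ dist x z < dset A x + e.
Proof.
  intros H1 He. apply NNPP; intros Hn.
  assert (Rmin 1 (dset A x + e) <= dset A x).
  - apply csup_ge; [|apply Rmin_l]. intros z Hz.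
    destruct (Rle_or_lt (Rmin 1 (dset A x + e)) (dist x z)) as [|Hlt]; auto.
    exfalso; apply Hn. exists z; split; auto.
    pose proof (Rmin_r 1 (dset A x + e)); lra.
  - revert H. apply Rmin_case; lra.
Qed.

(** * Compactness *)

Lemma is_open_ball {X : MetricSpace} (x : X) (r : R) : is_open (fun y => dist x y < r).
Proof.
  intros y Hy. exists (r - dist x y). split; [lra|].
  intros z Hz. pose proof (dist_tri X x y z). lra.
Qed.

Lemma list_min {I : Type} (v : I -> R) (l : list I) :
  (forall i, In i l -> 0 < v i) -> exists r, 0 < r /\ forall i, In i l -> r <= v i.
Proof.
  induction l as [|i l IH]; intros H.
  - exists 1. split; [lra|]. intros i [].
  - destruct IH as [r [Hr IH]]. { intros; apply H; now right. }
    exists (Rmin (v i) r). split. { apply Rmin_glb_lt; auto. apply H; now left. }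
    intros j [<- | Hj]. { apply Rmin_l. }
    pose proof (Rmin_r (v i) r). specialize (IH j Hj). lra.
Qed.

(** The minimum of the radii of a finite subcover serves everywhere. Indexing the cover by all good
    pairs of centre and radius avoids choosing a radius for each point. *)
Lemma compact_uniform {X : MetricSpace} (K : X -> Prop) (P : X -> R -> Prop) :
  compact_set K ->
  (forall x r r', 0 < r' <= r -> P x r -> P x r') ->
  (forall x, K x -> exists r, 0 < r /\ forall y, dist x y < r -> P y r) ->
  exists r, 0 < r /\ forall x, K x -> P x r.
Proof.
  intros HK Hmono Hloc.
  set (good := fun p : X * R => 0 < snd p /\ forall y, dist (fst p) y < snd p -> P y (snd p)).
  destruct (HK {p | good p} (fun p y => dist (fst (proj1_sig p)) y < snd (proj1_sig p)))
    as [l Hl].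
  - intros p. apply is_open_ball.
  - intros x Hx. destruct (Hloc x Hx) as [r [Hr H]].
    assert (Hg : good (x, r)) by (split; auto).
    exists (exist _ (x, r) Hg). simpl. now rewrite dist_refl.
  - destruct (list_min (fun p : {p | good p} => snd (proj1_sig p)) l) as [r [Hr Hmin]].
    + intros p _. exact (proj1 (proj2_sig p)).
    + exists r. split; auto. intros x Hx.
      destruct (Hl x Hx) as [p [Hp Hd]]. specialize (Hmin p Hp).
      apply (Hmono x (snd (proj1_sig p))); [lra|].
      destruct p as [p [Hp1 Hp2]]. simpl in *. auto.
Qed.

Lemma compact_closed_subset {X : MetricSpace} (K C : X -> Prop) :
  compact_set K -> is_closed C -> (forall x, C x -> K x) -> compact_set C.
Proof.
  intros HK HC Hsub I U HU Hcov.
  destruct (HK (option I)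
    (fun o x => match o with Some i => U i x | None => ~ C x end)) as [l Hl].
  - intros [i|]; [apply HU | apply HC].
  - intros x Hx. destruct (classic (C x)) as [HCx|HCx].
    + destruct (Hcov x HCx) as [i Hi]. now exists (Some i).
    + now exists None.
  - exists (flat_map (fun o => match o with Some i => i :: nil | None => nil end) l).
    intros x Hx. destruct (Hl x (Hsub x Hx)) as [[i|] [Hi Hu]]; [|contradiction].
    exists i. split; auto. apply in_flat_map. exists (Some i). simpl; auto.
Qed.

Lemma compact_is_closed {X : MetricSpace} (K : X -> Prop) : compact_set K -> is_closed K.
Proof.
  intros HK x Hx.
  destruct (compact_uniform K (fun y r => r <= dist x y) HK) as [r [Hr H]].
  - intros; lra.
  - intros y Hy. exists (dist x y / 2).
    assert (0 < dist x y).
    { destruct (dist_nonneg X x y) as [|He]; auto.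
      symmetry in He. apply dist_eq in He. subst. contradiction. }
    split; [lra|]. intros z Hz. pose proof (dist_tri X x z y).
    rewrite (dist_sym X z y) in *. lra.
  - exists r. split; auto. intros y Hy HKy. specialize (H y HKy). lra.
Qed.

Lemma compact_union {X : MetricSpace} (K L : X -> Prop) :
  compact_set K -> compact_set L -> compact_set (fun x => K x \/ L x).
Proof.
  intros HK HL I U HU Hcov.
  destruct (HK I U HU) as [l1 H1]. { intros; apply Hcov; auto. }
  destruct (HL I U HU) as [l2 H2]. { intros; apply Hcov; auto. }
  exists (l1 ++ l2). intros x [Hx|Hx].
  - destruct (H1 x Hx) as [i [Hi Hu]]. exists i. split; auto. apply in_or_app; auto.
  - destruct (H2 x Hx) as [i [Hi Hu]]. exists i. split; auto. apply in_or_app; auto.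
Qed.

Lemma compact_list_union {X : MetricSpace} {J : Type} (K : J -> X -> Prop) (l : list J) :
  (forall j, compact_set (K j)) -> compact_set (fun x => exists j, In j l /\ K j x).
Proof.
  intros HK. induction l as [|j l IH]; intros I U HU Hcov.
  - exists nil. intros x [j [[] _]].
  - destruct (compact_union _ _ (HK j) IH I U HU) as [m Hm].
    + intros x [Hx | [k [Hk Hx]]]; apply Hcov.
      * exists j; simpl; auto.
      * exists k; simpl; auto.
    + exists m. intros x [k [[<-|Hk] Hx]]; apply Hm; eauto.
Qed.

Lemma open_preimage {X Y : MetricSpace} (f : X -> Y) (U : Y -> Prop) :
  continuous f -> is_open U -> is_open (fun x => U (f x)).
Proof.
  intros Hf HU x Hx. destruct (HU _ Hx) as [r [Hr H]].
  destruct (Hf x r Hr) as [d [Hd H']]. exists d; auto.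
Qed.

Lemma compact_image {X Y : MetricSpace} (f : X -> Y) (K : X -> Prop) :
  continuous f -> compact_set K -> compact_set (fun y => exists x, K x /\ f x = y).
Proof.
  intros Hf HK I U HU Hcov.
  destruct (HK I (fun i x => U i (f x))) as [l Hl].
  - intros i. apply open_preimage; auto.
  - intros x Hx. apply Hcov. eauto.
  - exists l. intros y [x [Hx <-]]. auto.
Qed.

Lemma continuous_comp {X Y W : MetricSpace} (f : X -> Y) (g : Y -> W) :
  continuous f -> continuous g -> continuous (fun x => g (f x)).
Proof.
  intros Hf Hg x eps He. destruct (Hg (f x) eps He) as [d [Hd H]].
  destruct (Hf x d Hd) as [d' [Hd' H']]. exists d'; auto.
Qed.

Definition prodR (X : MetricSpace) : MetricSpace.
Proof.
  refine {| mcar := (X * R)%type;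
            dist := fun p q => dist (fst p) (fst q) + Rabs (snd p - snd q) |}.
  - intros [x t]; simpl. rewrite dist_refl, Rminus_diag, Rabs_R0. lra.
  - intros [x t] [y s] H; simpl in *. pose proof (dist_nonneg X x y).
    pose proof (Rabs_pos (t - s)).
    f_equal; [apply dist_eq; lra|].
    destruct (Req_dec (t - s) 0) as [|Hn]; [lra|]. apply Rabs_no_R0 in Hn. lra.
  - intros [x t] [y s]; simpl. now rewrite dist_sym, Rabs_minus_sym.
  - intros [x t] [y s] [z u]; simpl. pose proof (dist_tri X x y z).
    replace (t - u) with ((t - s) + (s - u)) by ring.
    pose proof (Rabs_triang (t - s) (s - u)). lra.
Defined.

(** Tube lemma and Heine-Borel in one: over a fixed [x], the supremum of the heights [s] for which
    finitely many [U i] cover a tube over [[0, s]] is attained and equal to [1]. *)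
Lemma compact_prod_interval {X : MetricSpace} (K : X -> Prop) :
  compact_set K -> compact_set (fun p : prodR X => K (fst p) /\ 0 <= snd p <= 1).
Proof.
  intros HK I U HU Hcov.
  set (tube := fun (s : R) (q : X * R * list I) => 0 < snd (fst q) /\ forall y t,
    dist (fst (fst q)) y < snd (fst q) -> 0 <= t <= s ->
    exists i, In i (snd q) /\ U i (y, t)).
  assert (Htube : forall x, K x -> exists r l, tube 1 (x, r, l)).
  { intros x Hx.
    assert (Hopen : forall t, 0 <= t <= 1 -> exists i d, 0 < d /\
      forall y t', dist x y < d -> Rabs (t - t') < d -> U i (y, t')).
    { intros t Ht. destruct (Hcov (x, t)) as [i Hi]; [simpl; auto|].
      destruct (HU i _ Hi) as [r [Hr H]]. exists i, (r / 2). split; [lra|].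
      intros y t' Hy Ht'. apply H. simpl. lra. }
    set (S := fun s => 0 <= s <= 1 /\ exists r l, tube s (x, r, l)).
    assert (H0 : S 0).
    { split; [lra|]. destruct (Hopen 0) as [i [d [Hd H]]]; [lra|].
      exists d, (i :: nil). split; auto. simpl. intros y t Hy Ht. exists i. split; auto.
      apply H; auto. replace (0 - t) with 0 by lra. now rewrite Rabs_R0. }
    destruct (completeness S) as [m [Hub Hlub]].
    { exists 1. intros s [Hs _]; apply Hs. }
    { now exists 0. }
    assert (Hm : 0 <= m <= 1).
    { split; [now apply Hub|]. apply Hlub. intros s [Hs _]; apply Hs. }
    destruct (Hopen m Hm) as [i [d [Hd H]]].
    assert (Hs : exists s, S s /\ m - d < s).
    { apply NNPP; intros Hn. assert (m <= m - d); [|lra].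
      apply Hlub. intros s Hs. destruct (Rle_or_lt s (m - d)); auto.
      exfalso; apply Hn; eauto. }
    destruct Hs as [s [[Hs1 [r [l [Hr Hl]]]] Hs2]]. simpl in *.
    (* A tube of height [s > m - d] and the box around [(x, m)] join to a tube that passes [m]
       unless [m = 1]. *)
    assert (HS : S (Rmin 1 (m + d / 2))).
    { split. { split; [apply Rmin_glb; lra | apply Rmin_l]. }
      exists (Rmin r d), (i :: l). split; simpl. { now apply Rmin_glb_lt. }
      intros y t Hy Ht. pose proof (Rmin_l r d). pose proof (Rmin_r r d).
      pose proof (Rmin_r 1 (m + d / 2)).
      destruct (Rle_or_lt t s).
      - destruct (Hl y t) as [j [Hj Hu]]; [lra | lra |]. exists j; auto.
      - exists i. split; auto. apply H; [lra|]. apply Rabs_def1; lra. }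
    pose proof (Hub _ HS) as Hle.
    assert (Rmin 1 (m + d / 2) = 1) as He. { revert Hle. apply Rmin_case; lra. }
    rewrite He in HS. exact (proj2 HS). }
  destruct (HK {q | tube 1 q}
    (fun q y => dist (fst (fst (proj1_sig q))) y < snd (fst (proj1_sig q)))) as [L HL].
  - intros q. apply is_open_ball.
  - intros x Hx. destruct (Htube x Hx) as [r [l Hq]]. exists (exist _ _ Hq). simpl.
    rewrite dist_refl. exact (proj1 Hq).
  - exists (flat_map (fun q => snd (proj1_sig q)) L). intros [x t] [Hx Ht]; simpl in *.
    destruct (HL x Hx) as [q [Hq Hd]].
    destruct (proj2 (proj2_sig q) x t Hd Ht) as [i [Hi Hu]].
    exists i. split; auto. apply in_flat_map. eauto.
Qed.

Definition clamp (t : R) : R := Rmax 0 (Rmin 1 t).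

Lemma clamp_bounds (t : R) : 0 <= clamp t <= 1.
Proof. unfold clamp. split; [apply Rmax_l|]. apply Rmax_lub; [lra | apply Rmin_l]. Qed.

Lemma clamp_id (t : R) : 0 <= t <= 1 -> clamp t = t.
Proof. intros. unfold clamp. rewrite Rmin_right, Rmax_right; lra. Qed.

Lemma clamp_lip (s t : R) : Rabs (clamp s - clamp t) <= Rabs (s - t).
Proof.
  unfold clamp, Rmax, Rmin, Rabs. repeat destruct (Rle_dec _ _);
  repeat destruct (Rcase_abs _); lra.
Qed.

(** [htpy_continuous] constrains a homotopy on [[0, 1]] only; clamping the time gives a map on the
    whole product, to which [compact_image] applies. *)
Lemma htpy_clamp_continuous {X Y : MetricSpace} (H : X -> R -> Y) :
  htpy_continuous H -> continuous (fun p : prodR X => H (fst p) (clamp (snd p))).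
Proof.
  intros HH [x t] eps He. simpl.
  destruct (HH x (clamp t) (clamp_bounds t) eps He) as [d [Hd H1]].
  exists d. split; auto. intros [y s] Hds. simpl in *.
  pose proof (dist_nonneg X x y). pose proof (clamp_lip t s).
  pose proof (Rabs_pos (t - s)).
  apply H1; [apply clamp_bounds | lra | lra].
Qed.

Lemma compact_htpy_image {X Y : MetricSpace} (H : X -> R -> Y) (K : X -> Prop) :
  htpy_continuous H -> compact_set K ->
  exists C : Y -> Prop, compact_set C /\ forall x t, K x -> 0 <= t <= 1 -> C (H x t).
Proof.
  intros HH HK. eexists. split.
  - exact (compact_image _ _ (htpy_clamp_continuous H HH) (compact_prod_interval K HK)).
  - intros x t Hx Ht. exists (x, t). simpl. rewrite clamp_id; auto.
Qed.

Lemma htpy_uniformly_small {X : MetricSpace} (H : X -> R -> X) :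
  compact_space X -> htpy_continuous H -> (forall x, H x 0 = x) ->
  forall eps, 0 < eps -> exists t, 0 < t <= 1 /\ forall x, dist x (H x t) < eps.
Proof.
  intros HX HH H0 eps He.
  destruct (compact_uniform (fun _ : X => True)
    (fun x r => forall t, 0 <= t <= 1 -> t < r -> dist x (H x t) < eps) HX) as [r [Hr Hu]].
  - intros x r r' Hr Hx t Ht Htr. apply Hx; lra.
  - intros x _. destruct (HH x 0 ltac:(lra) (eps / 2)) as [d [Hd Hx]]; [lra|].
    exists (Rmin d (eps / 2)). split; [apply Rmin_glb_lt; lra|].
    intros y Hy t Ht Htd. pose proof (Rmin_l d (eps / 2)). pose proof (Rmin_r d (eps / 2)).
    specialize (Hx y t Ht). rewrite H0 in Hx.
    assert (Rabs (0 - t) < d) by (apply Rabs_def1; lra).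
    pose proof (dist_tri X y x (H y t)). rewrite (dist_sym X y x) in *.
    specialize (Hx ltac:(lra) ltac:(lra)). lra.
  - exists (Rmin 1 (r / 2)). split.
    + split; [apply Rmin_glb_lt; lra | apply Rmin_l].
    + intros x. pose proof (Rmin_l 1 (r / 2)). pose proof (Rmin_r 1 (r / 2)).
      assert (0 < Rmin 1 (r / 2)) by (apply Rmin_glb_lt; lra).
      apply Hu; auto; lra.
Qed.

Lemma lebesgue_number {X : MetricSpace} {I : Type} (U : I -> X -> Prop) :
  compact_space X -> (forall i, is_open (U i)) -> (forall x, exists i, U i x) ->
  exists r, 0 < r /\ forall x, exists i, forall y, dist x y < r -> U i y.
Proof.
  intros HX HU Hcov.
  destruct (compact_uniform (fun _ : X => True)
    (fun x r => exists i, forall y, dist x y < r -> U i y) HX) as [r [Hr H]].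
  - intros x r r' Hr [i Hi]. exists i. intros y Hy. apply Hi. lra.
  - intros x _. destruct (Hcov x) as [i Hi]. destruct (HU i x Hi) as [r [Hr H]].
    exists (r / 2). split; [lra|]. intros y Hy. exists i. intros z Hz. apply H.
    pose proof (dist_tri X x y z). lra.
  - exists r; auto.
Qed.

(** As [Z] is closed, open sets of the subspace are open in [X], so covers can be transferred to [C]
    as a subset of [X]. *)
Lemma compact_in_complement {X : MetricSpace} (Z C : X -> Prop) :
  compact_space X -> is_closed Z -> is_closed C -> (forall x, C x -> ~ Z x) ->
  compact_set (fun x : subspace X (compl Z) => C (proj1_sig x)).
Proof.
  intros HX HZ HC Hdisj I U HU Hcov.
  assert (HCc : compact_set C).
  { apply (compact_closed_subset (fun _ => True)); auto. }
  destruct (HCc I (fun i x => exists h : compl Z x, U i (exist _ x h))) as [l Hl].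
  - intros i x [h Hi]. destruct (HU i _ Hi) as [r [Hr H]].
    destruct (HZ x h) as [r' [Hr' H']].
    exists (Rmin r r'). split; [now apply Rmin_glb_lt|].
    intros y Hy. pose proof (Rmin_l r r'). pose proof (Rmin_r r r').
    assert (hy : compl Z y) by (apply H'; lra).
    exists hy. apply H. simpl. lra.
  - intros x Hx. destruct (Hcov (exist _ x (Hdisj x Hx)) Hx) as [i Hi]. eauto.
  - exists l. intros [x hx] Hx. simpl in Hx. destruct (Hl x Hx) as [i [Hi [h Hu]]].
    exists i. split; auto. now rewrite (proof_irrelevance _ hx h).
Qed.

Lemma separable_cover {X Y W : MetricSpace} (f : X -> W) (g : Y -> W) :
  separable X -> separable Y -> continuous f -> continuous g ->
  (forall w, (exists x, f x = w) \/ (exists y, g y = w)) -> separable W.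
Proof.
  intros [s Hs] [s' Hs'] Hf Hg Hcov.
  exists (fun n => if Nat.even n then f (s (Nat.div2 n)) else g (s' (Nat.div2 n))).
  intros w r Hr. destruct (Hcov w) as [[x <-] | [y <-]].
  - destruct (Hf x r Hr) as [d [Hd H]]. destruct (Hs x d Hd) as [_ [[n <-] Hn]].
    exists (f (s n)). split; auto. exists (2 * n)%nat.
    now rewrite Nat.even_mul, Nat.div2_double.
  - destruct (Hg y r Hr) as [d [Hd H]]. destruct (Hs' y d Hd) as [_ [[n <-] Hn]].
    exists (g (s' n)). split; auto. exists (S (2 * n))%nat.
    rewrite Nat.even_succ, Nat.odd_mul, Nat.div2_succ_double. reflexivity.
Qed.

(** * Extension of maps into complements of closed sets of compact spaces *)

(** The cube with the uniform metric. Coordinates differ by at most [1], so the truncation in [csup]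
    changes nothing. *)
Definition fspace (I : Type) : MetricSpace.
Proof.
  refine {| mcar := {u : I -> R | forall i, 0 <= u i <= 1};
            dist := fun u v => csup (fun r => exists i, r = Rabs (proj1_sig u i - proj1_sig v i)) |}.
  - intros u. apply Rle_antisym; [|apply csup_nonneg].
    apply csup_le; [lra|]. intros x [i ->] _. rewrite Rminus_diag, Rabs_R0. lra.
  - intros [u Hu] [v Hv] H. simpl in H.
    assert (u = v).
    { extensionality i.
      assert (Rabs (u i - v i) <= 0).
      { rewrite <- H. apply csup_ge; eauto.
        specialize (Hu i). specialize (Hv i). apply Rabs_le. lra. }
      apply Rminus_diag_uniq. pose proof (Rabs_pos (u i - v i)).
      destruct (Req_dec (u i - v i) 0) as [|Hn]; auto. apply Rabs_pos_lt in Hn. lra. }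
    subst v. f_equal. apply proof_irrelevance.
  - intros u v. f_equal. extensionality r. f_equal. extensionality i.
    now rewrite Rabs_minus_sym.
  - intros u v w. apply csup_le.
    + apply Rplus_le_le_0_compat; apply csup_nonneg.
    + intros x [i ->] _.
      assert (forall a b : {u : I -> R | forall i, 0 <= u i <= 1},
        Rabs (proj1_sig a i - proj1_sig b i) <=
        csup (fun r => exists i, r = Rabs (proj1_sig a i - proj1_sig b i))) as Hab.
      { intros [a Ha] [b Hb]; simpl. apply csup_ge; eauto.
        specialize (Ha i). specialize (Hb i). apply Rabs_le. lra. }
      pose proof (Hab u v). pose proof (Hab v w).
      replace (proj1_sig u i - proj1_sig w i) with
        ((proj1_sig u i - proj1_sig v i) + (proj1_sig v i - proj1_sig w i)) by ring.
      eapply Rle_trans; [apply Rabs_triang | lra].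
Defined.

Lemma fdist_ge {I : Type} (u v : fspace I) (i : I) :
  Rabs (proj1_sig u i - proj1_sig v i) <= dist u v.
Proof.
  apply csup_ge; eauto. destruct u as [u Hu], v as [v Hv]; simpl.
  specialize (Hu i). specialize (Hv i). apply Rabs_le. lra.
Qed.

Lemma fdist_le {I : Type} (u v : fspace I) (b : R) :
  0 <= b -> (forall i, Rabs (proj1_sig u i - proj1_sig v i) <= b) -> dist u v <= b.
Proof. intros Hb H. apply csup_le; auto. intros x [i ->] _. apply H. Qed.

Lemma Rmax_close (a b a' b' e : R) :
  Rabs (a - a') <= e -> Rabs (b - b') <= e -> Rabs (Rmax a b - Rmax a' b') <= e.
Proof.
  unfold Rmax, Rabs. repeat destruct (Rle_dec _ _); repeat destruct (Rcase_abs _); lra.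
Qed.

Section Extension.
Context {Y : MetricSpace} {I : Type} (A : Y -> Prop) (HA : is_closed A)
  (u : subspace Y A -> fspace I).

(** A Dugundji-style extension by suprema instead of a partition of unity: the value at [a] is cut
    off at [2] minus the ratio of [dist y a] to [dset A y], which has no effect at ratio [1] and
    leaves nothing from ratio [2] on. *)
Definition ext_sup (y : Y) (i : I) : R :=
  csup (fun r => exists a : subspace Y A,
    r = Rmin (proj1_sig (u a) i) (2 - dist y (proj1_sig a) / dset A y)).

Lemma ext_sup_term (y : Y) (i : I) (a : subspace Y A) :
  Rmin (proj1_sig (u a) i) (2 - dist y (proj1_sig a) / dset A y) <= ext_sup y i.
Proof.
  apply csup_ge; eauto. eapply Rle_trans; [apply Rmin_l|]. apply (proj2_sig (u a)).
Qed.

(* The maximum with [dset A y] keeps the extension positive off [A]. *)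
Definition ext_val (y : Y) (i : I) : R := Rmax (ext_sup y i) (dset A y).

Lemma ext_val_bounds (y : Y) : forall i, 0 <= ext_val y i <= 1.
Proof.
  intros i. unfold ext_val. split.
  - eapply Rle_trans; [apply (dset_nonneg A y) | apply Rmax_r].
  - apply Rmax_lub; apply csup_le1.
Qed.

Definition ext (y : Y) : fspace I :=
  match excluded_middle_informative (A y) with
  | left h => u (exist _ y h)
  | right _ => exist _ (ext_val y) (ext_val_bounds y)
  end.

Lemma ext_in (a : subspace Y A) : ext (proj1_sig a) = u a.
Proof.
  destruct a as [y h]; simpl. unfold ext.
  destruct (excluded_middle_informative (A y)) as [h'|]; [|contradiction].
  now rewrite (proof_irrelevance _ h h').
Qed.

Lemma ext_out (y : Y) (i : I) : ~ A y -> proj1_sig (ext y) i = ext_val y i.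
Proof.
  intros Hy. unfold ext. destruct (excluded_middle_informative (A y)); [contradiction|].
  reflexivity.
Qed.

(** Only ratios [q <= 2] contribute, and moving [y] by [delta] raises such a ratio by at most [e]
    once [(1 + q + e) * delta <= e * dset A y]; the constant [4] bounds [1 + q + e]. *)
Lemma ext_sup_step (y y' : Y) (i : I) (e : R) :
  ~ A y -> ~ A y' -> 0 < e <= 1 -> 4 * dist y y' <= e * dset A y ->
  ext_sup y i <= ext_sup y' i + e.
Proof.
  intros Hy Hy' He Hd.
  pose proof (dset_pos A y HA Hy) as Hs. pose proof (dset_pos A y' HA Hy') as Hs'.
  pose proof (csup_nonneg (fun r => exists a : subspace Y A,
    r = Rmin (proj1_sig (u a) i) (2 - dist y' (proj1_sig a) / dset A y'))) as H0.
  fold (ext_sup y' i) in H0.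
  apply csup_le; [lra|]. intros x [a ->] _.
  pose proof (ext_sup_term y' i a) as Ht.
  set (v := proj1_sig (u a) i) in *.
  set (q := dist y (proj1_sig a) / dset A y) in *.
  set (q' := dist y' (proj1_sig a) / dset A y') in *.
  destruct (Rle_or_lt q 2) as [Hq|Hq].
  2:{ pose proof (Rmin_r v (2 - q)). lra. }
  assert (Hqq : q' <= q + e).
  { pose proof (dset_lip A y y'). pose proof (dist_tri Y y' y (proj1_sig a)) as Htri.
    rewrite (dist_sym Y y' y) in Htri.
    assert (Hdq : dist y (proj1_sig a) = q * dset A y) by (unfold q; field; lra).
    assert (Hdq' : dist y' (proj1_sig a) = q' * dset A y') by (unfold q'; field; lra).
    pose proof (dist_nonneg Y y (proj1_sig a)).
    apply Rmult_le_reg_r with (dset A y'); [lra|]. rewrite <- Hdq'.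
    assert (0 <= q). { unfold q. apply Rmult_le_pos; [lra|]. left. now apply Rinv_0_lt_compat. }
    pose proof (dist_nonneg Y y y'). nra. }
  destruct (Rle_or_lt v (2 - q')) as [Hv|Hv].
  - rewrite (Rmin_left v (2 - q')) in Ht by lra. pose proof (Rmin_l v (2 - q)). lra.
  - rewrite (Rmin_right v (2 - q')) in Ht by lra. pose proof (Rmin_r v (2 - q)). lra.
Qed.

Lemma ext_continuous : continuous u -> continuous ext.
Proof.
  intros Hu y eps0 Heps0.
  set (eps := Rmin (eps0 / 2) 1).
  assert (Heps : 0 < eps <= 1 /\ eps < eps0).
  { unfold eps. pose proof (Rmin_l (eps0 / 2) 1). pose proof (Rmin_r (eps0 / 2) 1).
    assert (0 < Rmin (eps0 / 2) 1) by (apply Rmin_glb_lt; lra). lra. }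
  destruct Heps as [He Hlt].
  destruct (classic (A y)) as [Hy|Hy].
  - set (a0 := exist _ y Hy : subspace Y A).
    destruct (Hu a0 eps ltac:(lra)) as [eta [Heta H]].
    (* A point [a] of ratio below [2] at [y'] lies within [3 * dist y y'] of [y], hence [eta / 3];
       [eps] absorbs the term [dset A y'] of [ext_val], and [1 / 2] keeps [dset A y'] below [1] for
       [dset_near]. *)
    exists (Rmin (eta / 3) (Rmin eps (1 / 2))). split.
    { repeat apply Rmin_glb_lt; lra. }
    intros y' Hd.
    pose proof (Rmin_l (eta / 3) (Rmin eps (1 / 2))).
    pose proof (Rmin_r (eta / 3) (Rmin eps (1 / 2))).
    pose proof (Rmin_l eps (1 / 2)). pose proof (Rmin_r eps (1 / 2)).
    replace (ext y) with (u a0) by (symmetry; apply (ext_in a0)).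
    destruct (classic (A y')) as [Hy'|Hy'].
    { set (a' := exist _ y' Hy' : subspace Y A).
      replace (ext y') with (u a') by (symmetry; apply (ext_in a')).
      assert (dist (u a0) (u a') < eps); [|lra]. apply H. simpl. lra. }
    apply Rle_lt_trans with eps; [|lra]. apply fdist_le; [lra|]. intros i.
    rewrite (ext_out y' i Hy'). unfold ext_val.
    pose proof (dset_pos A y' HA Hy') as Hs.
    assert (Hsd : dset A y' <= dist y y') by (rewrite dist_sym; now apply dset_le).
    pose proof (proj2_sig (u a0) i) as Hb. simpl in Hb.
    assert (Hclose : forall a : subspace Y A, dist y' (proj1_sig a) < 2 * dset A y' ->
      Rabs (proj1_sig (u a0) i - proj1_sig (u a) i) < eps).
    { intros a Ha. eapply Rle_lt_trans; [apply fdist_ge|]. apply H. simpl.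
      pose proof (dist_tri Y y y' (proj1_sig a)). lra. }
    assert (Hup : ext_sup y' i <= proj1_sig (u a0) i + eps).
    { apply csup_le; [lra|]. intros x [a ->] _.
      destruct (Rle_or_lt (2 * dset A y') (dist y' (proj1_sig a))) as [Hq|Hq].
      - pose proof (Rmin_r (proj1_sig (u a) i) (2 - dist y' (proj1_sig a) / dset A y')).
        assert (2 <= dist y' (proj1_sig a) / dset A y'); [|lra].
        apply Rmult_le_reg_r with (dset A y'); auto.
        unfold Rdiv. rewrite Rmult_assoc, Rinv_l; lra.
      - pose proof (Rmin_l (proj1_sig (u a) i) (2 - dist y' (proj1_sig a) / dset A y')).
        specialize (Hclose a Hq). apply Rabs_def2 in Hclose. lra. }
    assert (Hlow : proj1_sig (u a0) i - eps <= ext_sup y' i).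
    { destruct (dset_near A y' (eps * dset A y')) as [z [Hz Hzd]]; [lra | nra |].
      set (a := exist _ z Hz : subspace Y A).
      eapply Rle_trans; [|apply (ext_sup_term y' i a)].
      apply Rmin_glb.
      - assert (Ha : dist y' (proj1_sig a) < 2 * dset A y') by (simpl; nra).
        specialize (Hclose a Ha). apply Rabs_def2 in Hclose. lra.
      - assert (dist y' (proj1_sig a) / dset A y' <= 1 + eps); [|lra].
        apply Rmult_le_reg_r with (dset A y'); auto.
        unfold Rdiv. rewrite Rmult_assoc, Rinv_l by lra. simpl. lra. }
    apply Rabs_le. split.
    + assert (Rmax (ext_sup y' i) (dset A y') <= proj1_sig (u a0) i + eps); [|lra].
      apply Rmax_lub; lra.
    + pose proof (Rmax_l (ext_sup y' i) (dset A y')). lra.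
  - pose proof (dset_pos A y HA Hy) as Hs. pose proof (dset_le1 A y).
    (* [dset A y'] stays above [dset A y / 2], so [8] provides the factor [4] of [ext_sup_step] in
       both directions. *)
    exists (eps * dset A y / 8). split; [nra|]. intros y' Hd.
    pose proof (dset_lip A y y').
    assert (Hs' : dset A y / 2 < dset A y') by nra.
    assert (Hy' : ~ A y'). { intros Hy'. rewrite (dset_in A y' Hy') in Hs'. lra. }
    apply Rle_lt_trans with eps; [|lra]. apply fdist_le; [lra|]. intros i.
    rewrite (ext_out y i Hy), (ext_out y' i Hy'). apply Rmax_close.
    + pose proof (ext_sup_step y y' i eps Hy Hy' He ltac:(nra)).
      pose proof (ext_sup_step y' y i eps Hy' Hy He ltac:(rewrite dist_sym; nra)).
      apply Rabs_le. lra.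
    + eapply Rle_trans; [apply dset_abs|]. nra.
Qed.

Lemma ext_pos (y : Y) (i : I) : ~ A y -> 0 < proj1_sig (ext y) i.
Proof.
  intros Hy. rewrite ext_out by auto.
  eapply Rlt_le_trans; [apply (dset_pos A y HA Hy) | apply Rmax_r].
Qed.
End Extension.

(** * Absolute retracts as extensors *)

Section AbsoluteExtensor.
Context {Xh : MetricSpace} (Z : Xh -> Prop) (Hcpt : compact_space Xh).

(* The coordinate [None] vanishes exactly on [Z], the coordinates [Some p] separate points. *)
Definition kuratowski_val (x : Xh) (o : option Xh) : R :=
  match o with None => dset Z x | Some p => Rmin 1 (dist x p) end.

Lemma kuratowski_bounds (x : Xh) : forall o, 0 <= kuratowski_val x o <= 1.
Proof.
  intros [p|]; simpl.
  - split; [apply Rmin_glb; [lra | apply dist_nonneg] | apply Rmin_l].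
  - split; [apply dset_nonneg | apply dset_le1].
Qed.

Definition kuratowski (x : Xh) : fspace (option Xh) :=
  exist _ (kuratowski_val x) (kuratowski_bounds x).

Lemma kuratowski_lip (x y : Xh) : dist (kuratowski x) (kuratowski y) <= dist x y.
Proof.
  apply fdist_le; [apply dist_nonneg|]. intros [p|]; simpl.
  - pose proof (dist_tri Xh x y p). pose proof (dist_tri Xh y x p).
    rewrite (dist_sym Xh y x) in *.
    unfold Rmin, Rabs. repeat destruct (Rle_dec _ _); destruct (Rcase_abs _); lra.
  - apply dset_abs.
Qed.

Lemma kuratowski_inv (x y : Xh) :
  Rmin 1 (dist x y) <= dist (kuratowski x) (kuratowski y).
Proof.
  pose proof (fdist_ge (kuratowski x) (kuratowski y) (Some y)) as H. simpl in H.
  rewrite dist_refl, (Rmin_right 1 0), Rminus_0_r in H by lra.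
  rewrite Rabs_right in H; auto.
  apply Rle_ge, Rmin_glb; [lra | apply dist_nonneg].
Qed.

Lemma kuratowski_continuous : continuous kuratowski.
Proof.
  intros x eps He. exists eps. split; auto. intros y Hy.
  eapply Rle_lt_trans; [apply kuratowski_lip | auto].
Qed.

(** The map first extends with values in the cube; the complement of [Z] is closed in a suitable
    part [W] of the cube, and the retraction granted by [AR] brings the extension back. *)
Lemma AR_complement_extensor (Y : MetricSpace) (A : Y -> Prop)
    (u : subspace Y A -> subspace Xh (compl Z)) :
  AR (subspace Xh (compl Z)) -> separable Y -> is_closed A -> continuous u ->
  exists F : Y -> subspace Xh (compl Z), continuous F /\ forall a, F (proj1_sig a) = u a.
Proof.
  intros [HXsep HAR] HYsep HA Hu.
  set (ku := fun a => kuratowski (proj1_sig (u a))).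
  assert (Hku : continuous ku).
  { intros a eps He. destruct (Hu a eps He) as [d [Hd H]]. exists d. split; auto.
    intros b Hb. eapply Rle_lt_trans; [apply kuratowski_lip | apply (H b Hb)]. }
  pose proof (ext_continuous A HA ku Hku) as HE.
  (* [W] has only the values of the extension and the image of the complement of [Z], because the
     cube itself need not be separable. *)
  set (inW := fun v => (exists y, ext A ku y = v) \/
    (exists x : subspace Xh (compl Z), kuratowski (proj1_sig x) = v)).
  set (W := subspace (fspace (option Xh)) inW).
  set (F := fun y => exist inW (ext A ku y) (or_introl (ex_intro _ y eq_refl)) : W).
  set (j := fun x : subspace Xh (compl Z) =>
    exist inW (kuratowski (proj1_sig x)) (or_intror (ex_intro _ x eq_refl)) : W).
  assert (HF : continuous F) by exact HE.
  assert (Hj : continuous j).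
  { intros x eps He. destruct (kuratowski_continuous (proj1_sig x) eps He) as [d [Hd H]].
    exists d. split; auto. intros y Hy. now apply H. }
  assert (Hinv : forall x eps, 0 < eps -> exists delta, 0 < delta /\
     forall x', dist (j x) (j x') < delta -> dist x x' < eps).
  { intros x eps He. exists (Rmin 1 eps). split; [apply Rmin_glb_lt; lra|].
    intros x' Hd. simpl.
    pose proof (kuratowski_inv (proj1_sig x) (proj1_sig x')) as Hk.
    change (dist (kuratowski (proj1_sig x)) (kuratowski (proj1_sig x')) < Rmin 1 eps) in Hd.
    assert (Hlt : Rmin 1 (dist (proj1_sig x) (proj1_sig x')) < Rmin 1 eps) by lra.
    revert Hlt. unfold Rmin. repeat destruct (Rle_dec _ _); lra. }
  destruct (HAR W) with (j := j) as [r [Hr Hrj]].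
  - apply (separable_cover F j HYsep HXsep HF Hj).
    intros [v [[y Hy] | [x Hx]]]; [left | right].
    + exists y. now apply subspace_eq.
    + exists x. now apply subspace_eq.
  - split; [exact Hj|]. split; [|split; [exact Hinv|]].
    + intros x x' Hx. apply dist_eq. apply Rle_antisym; [|apply dist_nonneg].
      apply Rnot_lt_le. intros Hpos.
      destruct (Hinv x _ Hpos) as [d [Hd H]]. specialize (H x').
      rewrite Hx, dist_refl in H. specialize (H Hd). lra.
    + intros [v Hv] Hn.
      (* A point of [W] outside the image of [j] even avoids the compact image of [Xh]: values over
         [A] lie in the image of [j], and off [A] the coordinate [None] is positive, whereas it
         vanishes on [Z]. *)
      assert (Hout : ~ exists x, True /\ kuratowski x = v).
      { intros [x [_ Hx]]. destruct (classic (Z x)) as [HZx|HZx].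
        - destruct Hv as [[y Hy] | [x' Hx']].
          + destruct (classic (A y)) as [HAy|HAy].
            * apply Hn. exists (u (exist _ y HAy)). unfold j.
              assert (kuratowski (proj1_sig (u (exist A y HAy))) = v).
              { rewrite <- Hy. symmetry. apply (ext_in A ku (exist A y HAy)). }
              now apply subspace_eq.
            * pose proof (ext_pos A HA ku y None HAy) as Hp.
              rewrite Hy, <- Hx in Hp. simpl in Hp. rewrite dset_in in Hp by auto. lra.
          + apply Hn. exists x'. now apply subspace_eq.
        - apply Hn. exists (exist _ x HZx). now apply subspace_eq. }
      destruct (compact_is_closed _ (compact_image _ _ kuratowski_continuous Hcpt) v Hout)
        as [rad [Hrad H]].
      exists rad. split; auto. intros [v' Hv'] Hd [x Hx]. apply (H v' Hd).
      exists (proj1_sig x). split; auto. exact (f_equal (@proj1_sig _ _) Hx).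
  - exists (fun y => r (F y)). split; [exact (continuous_comp F r HF Hr)|].
    intros a. rewrite <- (Hrj (u a)). f_equal. apply subspace_eq. exact (ext_in A ku a).
Qed.
End AbsoluteExtensor.

(** * Compactifications by a Z-set *)

(** Rounding [t] up to a multiple of [/ INR (S N)], not down, keeps the approximation positive. *)
Lemma unit_approx (N : nat) (t : R) (m : nat) :
  0 < t <= INR m / INR (S N) -> exists k, (k < m)%nat /\ INR k / INR (S N) < t <= INR (S k) / INR (S N).
Proof.
  induction m as [|m IH]; intros Ht.
  - simpl in Ht. unfold Rdiv in Ht. rewrite Rmult_0_l in Ht. lra.
  - destruct (Rlt_or_le (INR m / INR (S N)) t) as [Hlt|Hle].
    + exists m. split; [lia | lra].
    + destruct IH as [k [Hk H]]; [lra|]. exists k. split; [lia | auto].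
Qed.

Lemma separable_half_open_cylinder (Y : MetricSpace) :
  separable Y -> separable (subspace (prodR Y) (fun p => 0 < snd p <= 1)).
Proof.
  intros [s Hs].
  (* These fractions are exactly the rationals in [(0, 1]], so every triple [n], [k], [m] decodes to
     a point of the cylinder. *)
  assert (Hq : forall k m : nat, 0 < INR (S k) / INR (S k + m) <= 1).
  { intros k m. assert (0 < INR (S k)) by (apply lt_0_INR; lia).
    assert (INR (S k) <= INR (S k + m)) by (apply le_INR; lia).
    split. { apply Rdiv_lt_0_compat; lra. }
    apply Rmult_le_reg_r with (INR (S k + m)); [lra|].
    unfold Rdiv. rewrite Rmult_assoc, Rinv_l; lra. }
  set (pt := fun n k m => exist (fun p : prodR Y => 0 < snd p <= 1)
    (s n, INR (S k) / INR (S k + m)) (Hq k m)).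
  exists (fun i => let (n, i') := Cantor.of_nat i in let (k, m) := Cantor.of_nat i' in pt n k m).
  intros [[y t] Ht] r Hr. simpl in Ht.
  destruct (Hs y (r / 2)) as [_ [[n <-] Hn]]; [lra|].
  destruct (archimed_cor1 (r / 2)) as [N [HN HN0]]; [lra|].
  destruct N as [|N]; [lia|].
  assert (HSN : 0 < INR (S N)) by (apply lt_0_INR; lia).
  destruct (unit_approx N t (S N)) as [k [Hk [Hlo Hhi]]].
  { unfold Rdiv. rewrite Rinv_r; lra. }
  exists (pt n k (N - k)%nat). split.
  - exists (Cantor.to_nat (n, Cantor.to_nat (k, (N - k)%nat))).
    now rewrite !Cantor.cancel_of_to.
  - change (dist y (s n) + Rabs (t - INR (S k) / INR (S k + (N - k))) < r).
    replace (S k + (N - k))%nat with (S N) by lia.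
    assert (INR (S k) / INR (S N) = INR k / INR (S N) + / INR (S N)).
    { rewrite (S_INR k). field. lra. }
    assert (Rabs (t - INR (S k) / INR (S N)) <= / INR (S N)); [|lra].
    apply Rabs_le. lra.
Qed.

Lemma separable_of_dense_complement {X : MetricSpace} (Z : X -> Prop) :
  dense (compl Z) -> separable (subspace X (compl Z)) -> separable X.
Proof.
  intros Hd [s Hs]. exists (fun n => proj1_sig (s n)). intros x r Hr.
  destruct (Hd x (r / 2)) as [y [Hy Hxy]]; [lra|].
  destruct (Hs (exist _ y Hy) (r / 2)) as [_ [[n <-] Hn]]; [lra|]. simpl in Hn.
  exists (proj1_sig (s n)). split; eauto. pose proof (dist_tri X x y (proj1_sig (s n))). lra.
Qed.

Lemma Zset_dense_complement {X : MetricSpace} (Z : X -> Prop) :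
  Zset Z -> dense (compl Z).
Proof.
  intros [_ [h [Hh [h0 hZ]]]] x r Hr.
  destruct (Hh x 0 ltac:(lra) r Hr) as [d [Hd H]].
  set (t := Rmin 1 (d / 2)).
  assert (Ht : 0 < t <= 1 /\ t < d).
  { unfold t. pose proof (Rmin_l 1 (d / 2)). pose proof (Rmin_r 1 (d / 2)).
    assert (0 < Rmin 1 (d / 2)) by (apply Rmin_glb_lt; lra). lra. }
  exists (h x t). split; [apply hZ; lra|].
  rewrite <- (h0 x) at 1. apply H; [lra | now rewrite dist_refl |].
  apply Rabs_def1; lra.
Qed.

(** The homotopy is sure to avoid [Z] at positive times only, so the extension takes place over
    [(0, 1]]; nothing is claimed about [phi] off the image of [j] as the time tends to [0]. *)
Lemma extend_homotopy_track {Xh Y : MetricSpace} (Z : Xh -> Prop)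
    (h : Xh -> R -> Xh) (j : Xh -> Y) :
  compact_space Xh -> AR (subspace Xh (compl Z)) -> separable Y ->
  htpy_continuous h -> (forall x t, 0 < t <= 1 -> ~ Z (h x t)) -> closed_embedding j ->
  exists phi : Y -> R -> Xh,
    (forall x t, 0 < t <= 1 -> phi (j x) t = h x t) /\
    (forall y t, 0 < t <= 1 -> forall eps, 0 < eps -> exists delta, 0 < delta /\
       forall y' t', 0 < t' <= 1 -> dist y y' < delta -> Rabs (t - t') < delta ->
       dist (phi y t) (phi y' t') < eps).
Proof.
  intros Hcpt HAR HYsep Hh hZ [Hj [Hinj [Hinv Hcl]]].
  set (Y' := subspace (prodR Y) (fun p => 0 < snd p <= 1)).
  set (A := fun p : Y' => exists x, j x = fst (proj1_sig p)).
  set (pre := fun a : subspace Y' A =>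
    proj1_sig (constructive_indefinite_description _ (proj2_sig a))).
  assert (Hpre : forall a, j (pre a) = fst (proj1_sig (proj1_sig a))).
  { intros a. exact (proj2_sig (constructive_indefinite_description _ (proj2_sig a))). }
  set (u := fun a : subspace Y' A => exist (compl Z) (h (pre a) (snd (proj1_sig (proj1_sig a))))
    (hZ _ _ (proj2_sig (proj1_sig a))) : subspace Xh (compl Z)).
  destruct (AR_complement_extensor Z Hcpt Y' A u HAR) as [F [HF HFu]].
  - now apply separable_half_open_cylinder.
  - intros p Hp. destruct (Hcl _ Hp) as [r [Hr H]]. exists r. split; auto.
    intros q Hq. apply H.
    change (dist (fst (proj1_sig p)) (fst (proj1_sig q)) +
      Rabs (snd (proj1_sig p) - snd (proj1_sig q)) < r) in Hq.
    pose proof (Rabs_pos (snd (proj1_sig p) - snd (proj1_sig q))). lra.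
  - intros a eps He.
    set (t := snd (proj1_sig (proj1_sig a))).
    assert (Ht : 0 < t <= 1) by exact (proj2_sig (proj1_sig a)).
    destruct (Hh (pre a) t ltac:(lra) eps He) as [d [Hd H]].
    destruct (Hinv (pre a) d Hd) as [d' [Hd' H']].
    exists (Rmin d d'). split; [now apply Rmin_glb_lt|]. intros b Hb.
    pose proof (Rmin_l d d'). pose proof (Rmin_r d d').
    change (dist (fst (proj1_sig (proj1_sig a))) (fst (proj1_sig (proj1_sig b))) +
      Rabs (t - snd (proj1_sig (proj1_sig b))) < Rmin d d') in Hb.
    rewrite <- !Hpre in Hb.
    pose proof (dist_nonneg Y (j (pre a)) (j (pre b))).
    pose proof (Rabs_pos (t - snd (proj1_sig (proj1_sig b)))).
    assert (Htb : 0 < snd (proj1_sig (proj1_sig b)) <= 1) by exact (proj2_sig (proj1_sig b)).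
    change (dist (h (pre a) t) (h (pre b) (snd (proj1_sig (proj1_sig b)))) < eps).
    apply H; [lra | | lra]. apply H'. lra.
  (* Outside [(0, 1]] any value will do; [F] at time [1] supplies a point of [Xh]. *)
  - exists (fun y t => match excluded_middle_informative (0 < t <= 1) with
      | left ht => proj1_sig (F (exist _ (y, t) ht))
      | right _ => h (proj1_sig (F (exist _ (y, 1) (conj Rlt_0_1 (Rle_refl 1))))) 0
      end).
    split.
    + intros x t Ht. destruct (excluded_middle_informative _) as [ht|]; [|contradiction].
      set (a := exist A (exist (fun p : prodR Y => 0 < snd p <= 1) (j x, t) ht)
        (ex_intro _ x eq_refl) : subspace Y' A).
      transitivity (proj1_sig (F (proj1_sig a))); [reflexivity|]. rewrite (HFu a).
      change (h (pre a) t = h x t). f_equal. apply Hinj. exact (Hpre a).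
    + intros y t Ht eps He. destruct (excluded_middle_informative _) as [ht|]; [|contradiction].
      destruct (HF (exist _ (y, t) ht) eps He) as [d [Hd H]].
      exists (d / 2). split; [lra|]. intros y' t' Ht' Hy Htt.
      destruct (excluded_middle_informative _) as [ht'|]; [|contradiction].
      apply (H (exist _ (y', t') ht')). simpl. lra.
Qed.

(** * Retraction along the extended push *)

Section Retraction.
Context {Xh Y : MetricSpace} (h : Xh -> R -> Xh) (j : Xh -> Y) (phi : Y -> R -> Xh)
  (Hcpt : compact_space Xh) (Hh : htpy_continuous h) (h0 : forall x, h x 0 = x)
  (Hj : closed_embedding j)
  (Hphij : forall x t, 0 < t <= 1 -> phi (j x) t = h x t)
  (Hphi : forall y t, 0 < t <= 1 -> forall eps, 0 < eps -> exists delta, 0 < delta /\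
       forall y' t', 0 < t' <= 1 -> dist y y' < delta -> Rabs (t - t') < delta ->
       dist (phi y t) (phi y' t') < eps).

Let A (y : Y) : Prop := exists x, j x = y.

(** For small [t], [j x] is close to [y] and [h x t] to [x], so a tracked value [phi y t]
    approximates a point whose image is near [y]. *)
Definition tracks (y : Y) (t : R) : Prop :=
  exists x, dist (j x) y < t /\ dist (phi y t) (h x t) < t.

(** On the image of [j] the maps [phi] and [h] agree, so each [(x, t)] with [t0 <= t] has a tracked
    neighbourhood; compactness of [Xh] and [[0, 1]] makes its size uniform. *)
Lemma tracks_near (t0 : R) : 0 < t0 <= 1 ->
  exists s, 0 < s <= 1 /\ forall y t, t0 <= t <= 1 -> dset A y < s -> tracks y t.
Proof.
  intros Ht0. destruct Hj as [Hjc _].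
  destruct (compact_uniform _ (fun (p : prodR Xh) r => t0 <= snd p <= 1 ->
      forall y, dist (j (fst p)) y < r -> tracks y (snd p))
    (compact_prod_interval (fun _ : Xh => True) Hcpt)) as [r [Hr H]].
  - intros p r r' Hr H Hp y Hy. apply H; [auto | lra].
  - intros [x t] [_ Ht]. simpl in Ht. destruct (Rlt_or_le t t0) as [Hlt|Hle].
    (* This radius keeps [t'] below [t0], where the claim is vacuous. *)
    + exists (t0 - t). split; [lra|]. intros [x' t'] Hd Ht'. exfalso. simpl in *.
      pose proof (dist_nonneg Xh x x'). pose proof (Rle_abs (t' - t)).
      rewrite Rabs_minus_sym in H0. lra.
    + destruct (Hphi (j x) t ltac:(lra) (t0 / 2) ltac:(lra)) as [da [Hda Ha]].
      destruct (Hh x t ltac:(lra) (t0 / 2) ltac:(lra)) as [db [Hdb Hb]].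
      set (e := Rmin da t0 / 2).
      assert (Hemin : 0 < e /\ 2 * e <= da /\ 2 * e <= t0).
      { unfold e. pose proof (Rmin_l da t0). pose proof (Rmin_r da t0).
        assert (0 < Rmin da t0) by (apply Rmin_glb_lt; lra). lra. }
      destruct (Hjc x e ltac:(lra)) as [dc [Hdc Hc]].
      exists (Rmin e (Rmin db dc)). split; [repeat apply Rmin_glb_lt; lra|].
      pose proof (Rmin_l e (Rmin db dc)). pose proof (Rmin_r e (Rmin db dc)).
      pose proof (Rmin_l db dc). pose proof (Rmin_r db dc).
      intros [x' t'] Hd Ht' y Hy. simpl in *.
      pose proof (dist_nonneg Xh x x'). pose proof (Rabs_pos (t - t')).
      specialize (Hc x' ltac:(lra)).
      pose proof (dist_tri Y (j x) (j x') y).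
      exists x. split; [lra|].
      specialize (Ha y t' ltac:(lra) ltac:(lra) ltac:(lra)).
      specialize (Hb x t' ltac:(lra) ltac:(rewrite dist_refl; lra) ltac:(lra)).
      rewrite Hphij in Ha by lra.
      pose proof (dist_tri Xh (phi y t') (h x t) (h x t')).
      rewrite (dist_sym Xh (phi y t') (h x t)) in *. lra.
  - exists (Rmin r 1). split. { split; [apply Rmin_glb_lt; lra | apply Rmin_r]. }
    intros y t Ht Hy. pose proof (Rmin_l r 1). pose proof (Rmin_r r 1).
    destruct (dset_near A y (Rmin r 1 - dset A y)) as [z [[x <-] Hz]]; [lra | lra |].
    apply (H (x, t)); simpl; [split; [auto | lra] | auto |].
    rewrite dist_sym. lra.
Qed.

(** Asking for tracking at all later times up to [1] makes the radius monotone in [t]. *)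
Definition track_radius (t : R) : R :=
  csup (fun s => forall y t', t <= t' <= 1 -> dset A y < s -> tracks y t').

Lemma track_radius_pos (t : R) : 0 < t <= 1 -> 0 < track_radius t.
Proof.
  intros Ht. destruct (tracks_near t Ht) as [s [Hs H]].
  apply Rlt_le_trans with s; [lra|]. apply csup_ge; [auto | lra].
Qed.

Lemma track_radius_mono (t t' : R) : t <= t' -> track_radius t <= track_radius t'.
Proof.
  intros Ht. apply csup_le; [apply csup_nonneg|]. intros s Hs Hs1.
  apply csup_ge; auto. intros y t1 Ht1. apply Hs. lra.
Qed.

Lemma track_radius_tracks (t : R) (y : Y) :
  t <= 1 -> dset A y < track_radius t -> tracks y t.
Proof.
  intros Ht Hy. destruct (csup_lt _ _ (dset_nonneg A y) Hy) as [s [Hs [_ Hlt]]].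
  apply Hs; [lra | auto].
Qed.

(* The supremum of functions [c] with [c s <= c s' <= (s' / s) * c s] for [s <= s'] inherits
   this property, which makes it continuous on the positive reals. *)
Definition tau (s : R) : R :=
  csup (fun r => exists t, 0 < t <= 1 /\ r = Rmin t (s / track_radius (t / 2))).

Lemma tau_term (s t : R) : 0 < t <= 1 -> Rmin t (s / track_radius (t / 2)) <= tau s.
Proof.
  intros Ht. apply csup_ge; eauto. eapply Rle_trans; [apply Rmin_l | lra].
Qed.

Lemma tau_pos (s : R) : 0 < s -> 0 < tau s.
Proof.
  intros Hs. eapply Rlt_le_trans; [|apply (tau_term s 1); lra].
  pose proof (track_radius_pos (1 / 2) ltac:(lra)).
  apply Rmin_glb_lt; [lra|]. now apply Rdiv_lt_0_compat.
Qed.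

Lemma tau_mono (s s' : R) : s <= s' -> tau s <= tau s'.
Proof.
  intros Hs. apply csup_le; [apply csup_nonneg|]. intros r [t [Ht ->]] _.
  eapply Rle_trans; [|apply (tau_term s' t Ht)]. apply Rle_min_compat_l.
  pose proof (track_radius_pos (t / 2) ltac:(lra)).
  apply Rmult_le_compat_r; [left; now apply Rinv_0_lt_compat | auto].
Qed.

Lemma tau_scale (s s' : R) : 0 < s <= s' -> s * tau s' <= s' * tau s.
Proof.
  intros Hs. pose proof (csup_nonneg
    (fun r => exists t, 0 < t <= 1 /\ r = Rmin t (s / track_radius (t / 2)))) as H0.
  fold (tau s) in H0.
  assert (tau s' <= s' / s * tau s).
  - assert (1 <= s' / s).
    { apply Rmult_le_reg_r with s; [lra|]. unfold Rdiv. rewrite Rmult_assoc, Rinv_l; lra. }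
    apply csup_le; [nra|]. intros r [t [Ht ->]] _.
    pose proof (tau_term s t Ht) as Hterm.
    pose proof (track_radius_pos (t / 2) ltac:(lra)).
    apply Rle_trans with (s' / s * Rmin t (s / track_radius (t / 2))); [|nra].
    destruct (Rle_or_lt t (s / track_radius (t / 2))) as [Hc|Hc].
    + rewrite (Rmin_left t (s / track_radius (t / 2))) by lra.
      eapply Rle_trans; [apply Rmin_l | nra].
    + rewrite (Rmin_right t (s / track_radius (t / 2))) by lra.
      eapply Rle_trans; [apply Rmin_r|]. right. field. lra.
  - replace (s' * tau s) with (s * (s' / s * tau s)) by (field; lra).
    apply Rmult_le_compat_l; lra.
Qed.

(** By [tau_scale], [a * (tau b - tau a) <= (b - a) * tau a] for [0 < a <= b], and [tau a <= 1]. *)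
Lemma tau_close (s s' : R) : 0 < s -> 0 < s' ->
  Rmin s s' * Rabs (tau s - tau s') <= Rabs (s - s').
Proof.
  assert (H : forall a b, 0 < a <= b -> a * Rabs (tau a - tau b) <= b - a).
  { intros a b Hab. pose proof (tau_mono a b ltac:(lra)). pose proof (tau_scale a b Hab).
    assert (tau a <= 1) by apply csup_le1. rewrite Rabs_left1 by lra. nra. }
  intros Hs Hs'. destruct (Rle_or_lt s s').
  - rewrite Rmin_left, (Rabs_left1 (s - s')) by lra. specialize (H s s' ltac:(lra)). lra.
  - rewrite Rmin_right, (Rabs_right (s - s')), Rabs_minus_sym by lra.
    apply (H s' s). lra.
Qed.

(** Terms with [t <= eps] are at most [eps]; for the others the radius at [t / 2] is at least that
    at [eps / 2], which explains [eta]. *)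
Lemma tau_small (eps : R) : 0 < eps <= 1 ->
  exists eta, 0 < eta /\ forall s, 0 <= s < eta -> tau s <= eps.
Proof.
  intros He. pose proof (track_radius_pos (eps / 2) ltac:(lra)) as Hd.
  exists (eps * track_radius (eps / 2)). split; [nra|]. intros s Hs.
  apply csup_le; [lra|]. intros r [t [Ht ->]] _.
  destruct (Rle_or_lt t eps) as [Hle|Hlt].
  - eapply Rle_trans; [apply Rmin_l | auto].
  - eapply Rle_trans; [apply Rmin_r|].
    pose proof (track_radius_mono (eps / 2) (t / 2) ltac:(lra)).
    apply Rmult_le_reg_r with (track_radius (t / 2)); [lra|].
    unfold Rdiv at 1. rewrite Rmult_assoc, Rinv_l by lra. nra.
Qed.

(** With [t = tau s < 1], the term of [t' = Rmin 1 (2 * t)] is at most [t < t'], so it is the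
    quotient [s / track_radius (t' / 2)]. As [t' / 2 <= t], this gives
    [s <= t * track_radius t < track_radius t]. The halving in [tau] makes room for [t' > t]. *)
Lemma tau_tracks (y : Y) : ~ A y -> tau (dset A y) < 1 -> tracks y (tau (dset A y)).
Proof.
  intros Hy H1. assert (Hs : 0 < dset A y) by (apply dset_pos; [apply Hj | auto]).
  pose proof (tau_pos _ Hs) as Ht. set (s := dset A y) in *. set (t := tau s) in *.
  apply track_radius_tracks; [lra|]. fold s.
  pose proof (track_radius_pos t ltac:(lra)).
  assert (Ht' : t < Rmin 1 (2 * t) <= 1 /\ Rmin 1 (2 * t) <= 2 * t).
  { split; [split; [apply Rmin_glb_lt; lra | apply Rmin_l] | apply Rmin_r]. }
  set (t' := Rmin 1 (2 * t)) in *.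
  pose proof (tau_term s t' ltac:(lra)) as Hterm. fold t in Hterm.
  pose proof (track_radius_mono (t' / 2) t ltac:(lra)).
  pose proof (track_radius_pos (t' / 2) ltac:(lra)).
  assert (Hq : s / track_radius (t' / 2) <= t).
  { revert Hterm. apply Rmin_case; lra. }
  assert (Hsq : s = s / track_radius (t' / 2) * track_radius (t' / 2)) by (field; lra).
  rewrite Hsq. nra.
Qed.

Lemma retraction_of_tracking : exists r : Y -> Xh, continuous r /\ forall x, r (j x) = x.
Proof.
  destruct Hj as [Hjc [Hinj [Hinv Hcl]]].
  set (r := fun y => match excluded_middle_informative (A y) with
    | left hy => proj1_sig (constructive_indefinite_description _ hy)
    | right _ => phi y (tau (dset A y)) end).
  assert (Hrj : forall x, r (j x) = x).
  { intros x. unfold r. destruct (excluded_middle_informative _) as [hy|hn].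
    - apply Hinj. exact (proj2_sig (constructive_indefinite_description _ hy)).
    - exfalso. apply hn. now exists x. }
  assert (Hrout : forall y, ~ A y -> r y = phi y (tau (dset A y))).
  { intros y Hy. unfold r. destruct (excluded_middle_informative _); [contradiction | auto]. }
  exists r. split; auto. intros y eps He.
  destruct (classic (A y)) as [[x <-]|Hy].
  - rewrite Hrj.
    destruct (Hh x 0 ltac:(lra) (eps / 2) ltac:(lra)) as [d1 [Hd1 H1]]. rewrite h0 in H1.
    destruct (Hinv x d1 Hd1) as [d2 [Hd2 H2]].
    destruct (Hinv x eps He) as [d3 [Hd3 H3]].
    (* For [tau] at most [e]: [1 / 2] makes [tau_tracks] apply, [d1] and [d2] bring [(x', t)] close
       to [(x, 0)], and [eps / 2] bounds the tracking error. *)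
    set (e := Rmin (Rmin (d1 / 2) (d2 / 2)) (Rmin (eps / 2) (1 / 2))).
    assert (Hemin : 0 < e /\ e <= d1 / 2 /\ e <= d2 / 2 /\ e <= eps / 2 /\ e <= 1 / 2).
    { unfold e.
      pose proof (Rmin_l (Rmin (d1 / 2) (d2 / 2)) (Rmin (eps / 2) (1 / 2))).
      pose proof (Rmin_r (Rmin (d1 / 2) (d2 / 2)) (Rmin (eps / 2) (1 / 2))).
      pose proof (Rmin_l (d1 / 2) (d2 / 2)). pose proof (Rmin_r (d1 / 2) (d2 / 2)).
      pose proof (Rmin_l (eps / 2) (1 / 2)). pose proof (Rmin_r (eps / 2) (1 / 2)).
      split; [repeat apply Rmin_glb_lt; lra | lra]. }
    destruct (tau_small e ltac:(lra)) as [eta [Heta Ht]].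
    exists (Rmin (Rmin d3 (d2 / 2)) eta). split; [repeat apply Rmin_glb_lt; lra|].
    pose proof (Rmin_l (Rmin d3 (d2 / 2)) eta). pose proof (Rmin_r (Rmin d3 (d2 / 2)) eta).
    pose proof (Rmin_l d3 (d2 / 2)). pose proof (Rmin_r d3 (d2 / 2)).
    intros y' Hd. destruct (classic (A y')) as [[x' <-]|Hy'].
    + rewrite Hrj. apply H3. lra.
    + rewrite Hrout by auto.
      assert (Hs : dset A y' <= dist (j x) y').
      { rewrite dist_sym. apply dset_le. now exists x. }
      specialize (Ht (dset A y') ltac:(pose proof (dset_nonneg A y'); lra)).
      pose proof (tau_pos _ (dset_pos A y' Hcl Hy')) as Htp.
      destruct (tau_tracks y' Hy' ltac:(lra)) as [x' [Hx1 Hx2]].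
      set (t := tau (dset A y')) in *.
      pose proof (dist_tri Y (j x) y' (j x')). rewrite (dist_sym Y y' (j x')) in *.
      assert (Hxx : dist x x' < d1) by (apply H2; lra).
      specialize (H1 x' t ltac:(lra) Hxx ltac:(apply Rabs_def1; lra)).
      pose proof (dist_tri Xh x (h x' t) (phi y' t)).
      rewrite (dist_sym Xh (h x' t) (phi y' t)) in *. lra.
  - pose proof (dset_pos A y Hcl Hy) as Hs. pose proof (tau_pos _ Hs) as Ht.
    rewrite Hrout by auto.
    assert (Ht1 : tau (dset A y) <= 1) by apply csup_le1.
    destruct (Hphi y (tau (dset A y)) ltac:(lra) eps He) as [d [Hd H]].
    set (s := dset A y) in *.
    (* [s / 2] keeps [dset A y'] above [s / 2]; then [tau_close] bounds the change of [tau] by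
       [2 / s] times the move, hence [d * s / 4]. *)
    set (del := Rmin (Rmin d (s / 2)) (d * s / 4)).
    assert (Hdel : 0 < del /\ del <= d /\ del <= s / 2 /\ del <= d * s / 4).
    { unfold del. pose proof (Rmin_l (Rmin d (s / 2)) (d * s / 4)).
      pose proof (Rmin_r (Rmin d (s / 2)) (d * s / 4)).
      pose proof (Rmin_l d (s / 2)). pose proof (Rmin_r d (s / 2)).
      split; [repeat apply Rmin_glb_lt; nra | lra]. }
    exists del. split; [lra|]. intros y' Hyy.
    pose proof (dset_lip A y y') as Hl1. pose proof (dset_abs A y y') as Hl2. fold s in Hl1, Hl2.
    assert (Hs' : s / 2 < dset A y') by lra.
    assert (Hy' : ~ A y'). { intros Hy'. rewrite (dset_in A y' Hy') in Hs'. lra. }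
    rewrite Hrout by auto.
    pose proof (tau_pos (dset A y') ltac:(lra)).
    assert (tau (dset A y') <= 1) by apply csup_le1.
    apply H; [lra | lra |].
    pose proof (tau_close s (dset A y') Hs ltac:(lra)) as Hc.
    pose proof (Rabs_pos (tau s - tau (dset A y'))).
    assert (Hmin : s / 2 < Rmin s (dset A y')) by (apply Rmin_glb_lt; lra).
    assert (s / 2 * Rabs (tau s - tau (dset A y')) < d * s / 2) by nra.
    apply Rmult_lt_reg_l with (s / 2); [lra|]. lra.
Qed.
End Retraction.

Theorem AR_of_Zset {Xh : MetricSpace} (Z : Xh -> Prop) :
  compact_space Xh -> Zset Z -> AR (subspace Xh (compl Z)) -> AR Xh.
Proof.
  intros Hcpt HZs HAR. split.
  - apply (separable_of_dense_complement Z); [now apply Zset_dense_complement | apply HAR].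
  - intros Y HY j Hj. destruct HZs as [_ [h [Hh [h0 hZ]]]].
    destruct (extend_homotopy_track Z h j) as [phi [H1 H2]]; auto.
    exact (retraction_of_tracking h j phi Hcpt Hh h0 Hj H1 H2).
Qed.

(** Preimages under [p] do not raise the order of a cover, and as [i (p x)] is close to [x], a
    suitably shrunk cover of [X] pulls back to a refinement. *)
Lemma dim_le_approximate {Xh X : MetricSpace} (n : nat) :
  compact_space Xh -> dim_le X n ->
  (forall eps, 0 < eps -> exists (p : Xh -> X) (i : X -> Xh),
     continuous p /\ continuous i /\ forall x, dist x (i (p x)) < eps) ->
  dim_le Xh n.
Proof.
  intros Hcpt Hdim Happ U HU Hcov.
  destruct (lebesgue_number (fun (V : {V | In V U}) => proj1_sig V) Hcpt) as [lam [Hlam HL]].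
  - intros [V HV]. now apply HU.
  - intros x. destruct (Hcov x) as [V [HV Hx]]. now exists (exist _ V HV).
  - destruct (Happ (lam / 2) ltac:(lra)) as [p [i [Hp [Hi Hpi]]]].
    (* A radius strictly above [lam / 2] makes [shrink V] open; the Lebesgue number [lam] makes
       these sets cover [X], and [lam / 2] absorbs the distance from [x] to [i (p x)]. *)
    set (shrink := fun (V : Xh -> Prop) (x : X) =>
      exists mu, lam / 2 < mu /\ forall y, dist (i x) y < mu -> V y).
    destruct (Hdim (map shrink U)) as [W [HW1 [HW2 [HW3 HW4]]]].
    + intros V' HV'. apply in_map_iff in HV'. destruct HV' as [V [<- HV]].
      intros x [mu [Hmu Hx]].
      destruct (Hi x ((mu - lam / 2) / 2) ltac:(lra)) as [d [Hd H]].
      exists d. split; auto. intros y Hy. exists (mu - (mu - lam / 2) / 2).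
      split; [lra|]. intros z Hz. apply Hx. specialize (H y Hy).
      pose proof (dist_tri Xh (i x) (i y) z). lra.
    + intros x. destruct (HL (i x)) as [[V HV] Hx]. exists (shrink V).
      split; [now apply in_map|]. exists lam. split; [lra | exact Hx].
    + exists (map (fun (V : X -> Prop) x => V (p x)) W). split; [|split; [|split]].
      * intros V' HV'. apply in_map_iff in HV'. destruct HV' as [V [<- HV]].
        apply open_preimage; auto.
      * intros x. destruct (HW2 (p x)) as [V [HV Hx]].
        exists (fun x => V (p x)). split; auto.
        apply (in_map (fun (V : X -> Prop) x => V (p x)) W V HV).
      * intros V' HV'. apply in_map_iff in HV'. destruct HV' as [V [<- HV]].
        destruct (HW3 V HV) as [U0 [HU0 Hsub]]. apply in_map_iff in HU0.
        destruct HU0 as [V0 [<- HV0]]. exists V0. split; auto.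
        intros x Hx. destruct (Hsub _ Hx) as [mu [Hmu Hm]]. apply Hm.
        rewrite dist_sym. specialize (Hpi x). lra.
      * intros x idx Hnd Hlen Hlt. rewrite length_map in Hlt.
        destruct (HW4 (p x) idx Hnd Hlen Hlt) as [k [Hk Hn]].
        exists k. split; auto.
        (* [map_nth] needs the default of [nth] in the form of a preimage, here of the empty set. *)
        change (fun _ : Xh => False) with
          ((fun (V : X -> Prop) x => V (p x)) (fun _ => False)).
        now rewrite map_nth.
Qed.

(** * Attaching a boundary along a map *)

Section Glue.
Context {X Y : MetricSpace} (Z : Y -> Prop) (HZ : is_closed Z)
  (f : X -> subspace Y (compl Z)).

Definition base (p : X + {z | Z z}) : Y :=
  match p with inl x => proj1_sig (f x) | inr z => proj1_sig z end.

Definition depth (p : X + {z | Z z}) : R := dset Z (base p).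

(* The metric of [X] with all of [Z] collapsed to one point at distance [depth p] from [p]. *)
Definition collapsed_dist (p q : X + {z | Z z}) : R :=
  match p, q with
  | inl x, inl y => Rmin (dist x y + dist (base p) (base q)) (depth p + depth q)
  | _, _ => depth p + depth q
  end.

Lemma depth_inr (z : {z | Z z}) : depth (inr z) = 0.
Proof. unfold depth; simpl. apply dset_in. apply (proj2_sig z). Qed.

Lemma depth_inl (x : X) : 0 < depth (inl x).
Proof. unfold depth; simpl. apply dset_pos; auto. apply (proj2_sig (f x)). Qed.

Lemma depth_nonneg (p : X + {z | Z z}) : 0 <= depth p.
Proof. apply dset_nonneg. Qed.

Lemma depth_lip (p q : X + {z | Z z}) : depth p <= depth q + dist (base p) (base q).
Proof. apply dset_lip. Qed.

Lemma collapsed_dist_le (p q : X + {z | Z z}) : collapsed_dist p q <= depth p + depth q.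
Proof.
  destruct p, q; unfold collapsed_dist; try apply Rle_refl. apply Rmin_r.
Qed.

Lemma collapsed_dist_nonneg (p q : X + {z | Z z}) : 0 <= collapsed_dist p q.
Proof.
  pose proof (depth_nonneg p). pose proof (depth_nonneg q).
  destruct p as [x|], q as [y|]; unfold collapsed_dist; try lra.
  pose proof (dist_nonneg X x y). pose proof (dist_nonneg Y (base (inl x)) (base (inl y))).
  apply Rmin_glb; lra.
Qed.

(** The distance of the bases is part of [collapsed_dist] for the sake of this bound, on which the
    triangle inequality rests: [depth] need not be Lipschitz for the metric of [X] alone. *)
Lemma depth_collapsed (p q : X + {z | Z z}) : depth p <= collapsed_dist p q + depth q.
Proof.
  pose proof (depth_lip p q). pose proof (depth_nonneg p). pose proof (depth_nonneg q).
  destruct p as [x|], q as [y|]; unfold collapsed_dist; try lra.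
  pose proof (dist_nonneg X x y). apply Rmin_case; lra.
Qed.

Lemma collapsed_dist_sym (p q : X + {z | Z z}) : collapsed_dist p q = collapsed_dist q p.
Proof.
  destruct p as [x|], q as [y|]; unfold collapsed_dist; try apply Rplus_comm.
  now rewrite (dist_sym X), (dist_sym Y), (Rplus_comm (depth (inl x))).
Qed.

Lemma collapsed_dist_tri (p q r : X + {z | Z z}) :
  collapsed_dist p r <= collapsed_dist p q + collapsed_dist q r.
Proof.
  pose proof (collapsed_dist_le p r). pose proof (depth_collapsed p q).
  pose proof (depth_collapsed r q). rewrite (collapsed_dist_sym r q) in *.
  pose proof (depth_nonneg p). pose proof (depth_nonneg q). pose proof (depth_nonneg r).
  destruct p as [x|z], q as [y|z'], r as [w|z'']; unfold collapsed_dist in *; try lra.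
  pose proof (dist_tri X x y w).
  pose proof (dist_tri Y (base (inl x)) (base (inl y)) (base (inl w))).
  pose proof (Rmin_l (dist x w + dist (base (inl x)) (base (inl w)))
    (depth (inl x) + depth (inl w))).
  revert H0 H1.
  apply (Rmin_case (dist x y + _)); apply (Rmin_case (dist y w + _)); lra.
Qed.

(** [collapsed_dist] gives the topology around points of [X], and the distance of the bases
    separates the points of [Z]. *)
Definition glue : MetricSpace.
Proof.
  refine {| mcar := (X + {z | Z z})%type;
            dist := fun p q => dist (base p) (base q) + collapsed_dist p q |}.
  - intros p. rewrite dist_refl.
    destruct p as [x|z]; unfold collapsed_dist.
    + rewrite !dist_refl, Rmin_left; [lra|]. pose proof (depth_inl x). lra.
    + rewrite depth_inr. lra.
  - intros p q H. pose proof (dist_nonneg Y (base p) (base q)).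
    pose proof (collapsed_dist_nonneg p q).
    assert (Hb : dist (base p) (base q) = 0) by lra.
    assert (Hc : collapsed_dist p q = 0) by lra. apply dist_eq in Hb.
    destruct p as [x|z], q as [y|z']; unfold collapsed_dist in Hc.
    + f_equal. apply dist_eq. pose proof (dist_nonneg X x y).
      pose proof (depth_inl x). pose proof (depth_inl y).
      rewrite Hb, dist_refl in Hc. revert Hc. apply Rmin_case; lra.
    + pose proof (depth_inl x). rewrite depth_inr in Hc. lra.
    + pose proof (depth_inl y). rewrite depth_inr in Hc. lra.
    + f_equal. destruct z, z'. simpl in Hb. subst. f_equal. apply proof_irrelevance.
  - intros p q. now rewrite dist_sym, collapsed_dist_sym.
  - intros p q r. pose proof (collapsed_dist_tri p q r).
    pose proof (dist_tri Y (base p) (base q) (base r)). lra.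
Defined.

Lemma glue_dist_eq (p q : glue) : dist p q = dist (base p) (base q) + collapsed_dist p q.
Proof. reflexivity. Qed.

Lemma base_lip (p q : glue) : dist (base p) (base q) <= dist p q.
Proof. rewrite glue_dist_eq. pose proof (collapsed_dist_nonneg p q). lra. Qed.

Lemma glue_dist_le (p q : glue) :
  dist p q <= dist (base p) (base q) + depth p + depth q.
Proof. rewrite glue_dist_eq. pose proof (collapsed_dist_le p q). lra. Qed.

(** The depth of [p] is at most the distance of its base to [z]. So continuity at infinity can be
    checked in [Y], at the cost of a factor [2]. *)
Lemma glue_dist_inr (p : glue) (z : {z | Z z}) :
  dist p (inr z : glue) <= 2 * dist (base p) (proj1_sig z).
Proof.
  pose proof (glue_dist_le p (inr z)). pose proof (depth_lip p (inr z)).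
  rewrite depth_inr in *. simpl in *. lra.
Qed.

Lemma depth_glue_lip (p q : glue) : depth p <= depth q + dist p q.
Proof. pose proof (depth_lip p q). pose proof (base_lip p q). lra. Qed.

Lemma glue_dist_inl_inr (x : X) (z : {z | Z z}) :
  depth (inl x) <= dist (inl x : glue) (inr z : glue).
Proof. pose proof (depth_glue_lip (inl x) (inr z)). rewrite depth_inr in *. lra. Qed.

Lemma inl_continuous : continuous f -> continuous (inl : X -> glue).
Proof.
  intros Hf x eps He. destruct (Hf x (eps / 3) ltac:(lra)) as [d [Hd H]].
  exists (Rmin d (eps / 3)). split; [apply Rmin_glb_lt; lra|]. intros y Hy.
  pose proof (Rmin_l d (eps / 3)). pose proof (Rmin_r d (eps / 3)).
  specialize (H y ltac:(lra)). rewrite glue_dist_eq. unfold collapsed_dist.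
  pose proof (Rmin_l (dist x y + dist (base (inl x)) (base (inl y)))
    (depth (inl x) + depth (inl y))).
  change (dist (base (inl x)) (base (inl y)) < eps / 3) in H. lra.
Qed.

(** Closer to [inl x] than its depth there is no point at infinity, and the minimum in
    [collapsed_dist] is its first argument. *)
Lemma inl_inverse_continuous (x : X) (eps : R) :
  0 < eps -> exists d, 0 < d /\
    forall p : glue, dist (inl x : glue) p < d -> exists y, p = inl y /\ dist x y < eps.
Proof.
  intros He. pose proof (depth_inl x).
  exists (Rmin eps (depth (inl x))). split; [now apply Rmin_glb_lt|].
  pose proof (Rmin_l eps (depth (inl x))). pose proof (Rmin_r eps (depth (inl x))).
  intros [y|z] Hd.
  - exists y. split; auto. rewrite glue_dist_eq in Hd. unfold collapsed_dist in Hd.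
    pose proof (dist_nonneg Y (base (inl x)) (base (inl y))).
    pose proof (depth_inl y). revert Hd. apply Rmin_case; lra.
  - pose proof (glue_dist_inl_inr x z). lra.
Qed.

Definition at_infinity (p : glue) : Prop :=
  match p with inl _ => False | inr _ => True end.

Lemma at_infinity_closed : is_closed at_infinity.
Proof.
  intros [x|z] Hp; [|exfalso; apply Hp; exact I].
  destruct (inl_inverse_continuous x 1 Rlt_0_1) as [d [Hd H]]. exists d. split; auto.
  intros p Hx. destruct (H p Hx) as [y [-> _]]. intros [].
Qed.

Definition to_finite (x : X) : subspace glue (compl at_infinity) :=
  exist (compl at_infinity) (inl x : glue) (fun h => h).

Definition of_finite (p : subspace glue (compl at_infinity)) : X :=
  match p with
  | exist _ (inl x) _ => x
  | exist _ (inr z) h => False_rect X (h I)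
  end.

Lemma of_to_finite (x : X) : of_finite (to_finite x) = x.
Proof. reflexivity. Qed.

Lemma to_of_finite (p : subspace glue (compl at_infinity)) : to_finite (of_finite p) = p.
Proof.
  apply subspace_eq. destruct p as [[x|z] h]; simpl; auto. exfalso; apply h; exact I.
Qed.

Lemma to_finite_continuous : continuous f -> continuous to_finite.
Proof. intros Hf. exact (inl_continuous Hf). Qed.

Lemma of_finite_continuous : continuous of_finite.
Proof.
  intros p eps He. rewrite <- (to_of_finite p). rewrite of_to_finite.
  destruct (inl_inverse_continuous (of_finite p) eps He) as [d [Hd H]].
  exists d. split; auto. intros q Hq. rewrite <- (to_of_finite q) in Hq |- *.
  destruct (H _ Hq) as [y [Hy Hlt]]. simpl in Hy. injection Hy as ->. exact Hlt.
Qed.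

Lemma infinity_homeomorphic :
  homeomorphic (subspace glue at_infinity) (subspace Y Z).
Proof.
  set (fw := fun p : subspace glue at_infinity =>
    match p return {z | Z z} with
    | exist _ (inl x) h => False_rect _ h
    | exist _ (inr z) _ => z
    end).
  set (bw := fun z : subspace Y Z => exist at_infinity (inr z : glue) I).
  assert (Hbf : forall p, bw (fw p) = p).
  { intros [[x|z] h]; [destruct h|]. now apply subspace_eq. }
  assert (Hdist : forall z z' : subspace Y Z,
    @dist (subspace glue at_infinity) (bw z) (bw z') = dist z z').
  { intros z z'. change (@dist glue (inr z) (inr z') = dist (proj1_sig z) (proj1_sig z')).
    rewrite glue_dist_eq. unfold collapsed_dist. rewrite !depth_inr. simpl. lra. }
  exists fw, bw. split; [|split; [|split]]; auto.
  - intros p eps He. exists eps. split; auto. intros q Hq.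
    rewrite <- (Hbf p), <- (Hbf q), Hdist in Hq. exact Hq.
  - intros z eps He. exists eps. split; auto. intros z' Hz. now rewrite Hdist.
Qed.

(** Finitely many [U i] cover everything over a neighbourhood of [Z]; the rest lies over a compact
    subset of the complement of [Z], whose preimage is compact as [f] is proper. *)
Lemma glue_compact :
  compact_space Y -> continuous f ->
  (forall C, compact_set C -> compact_set (fun x => C (f x))) ->
  compact_space glue.
Proof.
  intros HY Hf Hproper I U HU Hcov.
  assert (HZc : compact_set Z) by (apply (compact_closed_subset (fun _ => True)); auto).
  (* Every point over [V i] lies in [U i]; the factor [2] is that of [glue_dist_inr]. *)
  set (V := fun (i : I) (y : Y) => exists (z : {z | Z z}) r,
    (forall p : glue, dist (inr z : glue) p < 2 * r -> U i p) /\ dist (proj1_sig z) y < r).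
  destruct (HZc I V) as [l1 H1].
  { intros i y [z [r [Hr Hy]]]. destruct (is_open_ball (proj1_sig z) r y Hy) as [d [Hd H]].
    exists d. split; auto. intros y' Hy'. exists z, r. auto. }
  { intros z Hz. destruct (Hcov (inr (exist _ z Hz)) Logic.I) as [i Hi].
    destruct (HU i _ Hi) as [r [Hr H]]. exists i, (exist _ z Hz), (r / 2). split.
    - intros p Hp. apply H. eapply Rlt_le_trans; [exact Hp | lra].
    - simpl. rewrite dist_refl. lra. }
  set (C := fun y => forall i, In i l1 -> ~ V i y).
  assert (HC : is_closed C).
  { intros y Hy. apply not_all_ex_not in Hy. destruct Hy as [i Hi].
    apply imply_to_and in Hi. destruct Hi as [Hi Hv]. apply NNPP in Hv.
    destruct Hv as [z [r [Hr Hy]]]. destruct (is_open_ball (proj1_sig z) r y Hy) as [d [Hd H]].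
    exists d. split; auto. intros y' Hy' HC. apply (HC i Hi). exists z, r. auto. }
  assert (HCZ : forall y, C y -> ~ Z y).
  { intros y Hy Hz. destruct (H1 y Hz) as [i [Hi Hv]]. exact (Hy i Hi Hv). }
  destruct (Hproper _ (compact_in_complement Z C HY HZ HC HCZ) I (fun i x => U i (inl x)))
    as [l2 H2].
  { intros i. exact (open_preimage _ _ (inl_continuous Hf) (HU i)). }
  { intros x _. apply Hcov. exact Logic.I. }
  exists (l1 ++ l2). intros p _.
  destruct (classic (C (base p))) as [Hp|Hp].
  - destruct p as [x|z]; [|exfalso; exact (HCZ _ Hp (proj2_sig z))].
    destruct (H2 x Hp) as [i [Hi Hu]]. exists i. split; auto. apply in_or_app; auto.
  - apply not_all_ex_not in Hp. destruct Hp as [i Hi].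
    apply imply_to_and in Hi. destruct Hi as [Hi Hv]. apply NNPP in Hv.
    destruct Hv as [z [r [Hr Hy]]]. exists i. split; [apply in_or_app; auto|].
    apply Hr. rewrite (dist_sym glue). eapply Rle_lt_trans; [apply glue_dist_inr|].
    rewrite (dist_sym Y). lra.
Qed.

(** * Pushing the glued space off infinity *)

Section PushIn.
Context (k : subspace Y (compl Z) -> X) (J : X -> R -> X) (h : Y -> R -> Y)
  (Hf : continuous f) (Hk : continuous k) (HJ : htpy_continuous J) (Hh : htpy_continuous h)
  (J0 : forall x, J x 0 = k (f x)) (J1 : forall x, J x 1 = x)
  (h0 : forall y, h y 0 = y) (hZ : forall y t, 0 < t <= 1 -> ~ Z (h y t))
  (Hkctl : forall eps, 0 < eps -> exists d, 0 < d /\ forall y : subspace Y (compl Z),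
     dset Z (proj1_sig y) < d -> dist (f (k y)) y < eps)
  (HJctl : forall eps, 0 < eps -> exists d, 0 < d /\ forall x t, 0 <= t <= 1 ->
     dset Z (proj1_sig (f x)) < d -> dist (f (J x t)) (f x) < eps).

Definition k_ext (y : Y) : glue :=
  match excluded_middle_informative (Z y) with
  | left h => inr (exist _ y h)
  | right h => inl (k (exist _ y h))
  end.

Lemma k_ext_in (y : Y) (hy : Z y) : k_ext y = inr (exist _ y hy).
Proof.
  unfold k_ext. destruct (excluded_middle_informative (Z y)) as [h'|]; [|contradiction].
  now rewrite (proof_irrelevance _ hy h').
Qed.

Lemma k_ext_out (y : Y) (hy : compl Z y) : k_ext y = inl (k (exist _ y hy)).
Proof.
  unfold k_ext. destruct (excluded_middle_informative (Z y)) as [|h']; [contradiction|].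
  now rewrite (proof_irrelevance _ hy h').
Qed.

Lemma k_ext_continuous : continuous k_ext.
Proof.
  intros y eps He. destruct (classic (Z y)) as [Hy|Hy].
  - rewrite (k_ext_in y Hy).
    destruct (Hkctl (eps / 4) ltac:(lra)) as [d [Hd H]].
    exists (Rmin d (eps / 4)). split; [apply Rmin_glb_lt; lra|]. intros y' Hyy.
    pose proof (Rmin_l d (eps / 4)). pose proof (Rmin_r d (eps / 4)).
    rewrite dist_sym. eapply Rle_lt_trans; [apply glue_dist_inr|]. simpl.
    rewrite (dist_sym Y y y') in Hyy.
    destruct (classic (Z y')) as [Hy'|Hy'].
    + rewrite (k_ext_in y' Hy'). simpl. lra.
    + rewrite (k_ext_out y' Hy'). simpl.
      pose proof (dset_le Z y' y Hy).
      specialize (H (exist _ y' Hy') ltac:(simpl; lra)). simpl in H.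
      pose proof (dist_tri Y (proj1_sig (f (k (exist _ y' Hy')))) y' y).
      unfold compl in *. lra.
  - rewrite (k_ext_out y Hy).
    destruct (continuous_comp k _ Hk (inl_continuous Hf) (exist _ y Hy) eps He) as [d [Hd H]].
    destruct (HZ y Hy) as [r [Hr H']].
    exists (Rmin d r). split; [now apply Rmin_glb_lt|]. intros y' Hyy.
    pose proof (Rmin_l d r). pose proof (Rmin_r d r).
    assert (Hy' : compl Z y') by (apply H'; lra).
    rewrite (k_ext_out y' Hy'). apply H. simpl. lra.
Qed.

Definition J_ext (p : glue) (s : R) : glue :=
  match p with inl x => inl (J x s) | inr z => inr z end.

(** One [d] has to serve all [s]: [sigma] has no limit where depth and time both vanish, so
    continuity of [push] there cannot rely on a particular [s]. *)
Lemma J_ext_inr (z : {z | Z z}) (eps : R) : 0 < eps -> exists d, 0 < d /\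
  forall (p : glue) s, 0 <= s <= 1 -> dist (inr z : glue) p < d ->
    dist (inr z : glue) (J_ext p s) < eps.
Proof.
  intros He. destruct (HJctl (eps / 4) ltac:(lra)) as [d [Hd H]].
  exists (Rmin d (eps / 4)). split; [apply Rmin_glb_lt; lra|]. intros p s Hs Hp.
  pose proof (Rmin_l d (eps / 4)). pose proof (Rmin_r d (eps / 4)).
  destruct p as [x|z']; simpl J_ext; [|lra].
  rewrite dist_sym in Hp |- *. eapply Rle_lt_trans; [apply glue_dist_inr|].
  pose proof (base_lip (inl x) (inr z)) as Hb. pose proof (glue_dist_inl_inr x z).
  unfold depth in *. simpl base in *.
  specialize (H x s Hs ltac:(lra)).
  change (dist (proj1_sig (f (J x s))) (proj1_sig (f x)) < eps / 4) in H.
  pose proof (dist_tri Y (proj1_sig (f (J x s))) (proj1_sig (f x)) (proj1_sig z)). lra.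
Qed.

Lemma J_ext_continuous : htpy_continuous J_ext.
Proof.
  intros [x|z] s Hs eps He.
  - destruct (inl_continuous Hf (J x s) eps He) as [d [Hd H]].
    destruct (HJ x s Hs d Hd) as [d' [Hd' H']].
    destruct (inl_inverse_continuous x d' Hd') as [d'' [Hd'' H'']].
    exists (Rmin d' d''). split; [now apply Rmin_glb_lt|].
    pose proof (Rmin_l d' d''). pose proof (Rmin_r d' d'').
    intros p s' Hs' Hp Hss. destruct (H'' p ltac:(lra)) as [y [-> Hy]].
    simpl J_ext. apply H. apply H'; auto. lra.
  - destruct (J_ext_inr z eps He) as [d [Hd H]]. exists d. split; [auto|]. intros; now apply H.
Qed.

Lemma push_h_continuous : htpy_continuous (fun (p : glue) s => k_ext (h (base p) s)).
Proof.
  intros p s Hs eps He.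
  destruct (k_ext_continuous (h (base p) s) eps He) as [d [Hd H]].
  destruct (Hh (base p) s Hs d Hd) as [d' [Hd' H']].
  exists d'. split; auto. intros q s' Hs' Hq Hss. apply H. apply H'; auto.
  pose proof (base_lip p q). lra.
Qed.

(* For [s] from [1] down to [0] this runs [J] from the identity to [k f], fixing infinity;
   for [s] from [0] down to [-1] it pushes infinity inward. *)
Definition track (p : glue) (s : R) : glue :=
  if Rle_dec 0 s then J_ext p s else k_ext (h (base p) (- s)).

Lemma track_zero (p : glue) : J_ext p 0 = k_ext (h (base p) 0).
Proof.
  rewrite h0. destruct p as [x|z]; simpl.
  - rewrite J0. destruct (f x) as [y hy]; simpl. now rewrite (k_ext_out y hy).
  - destruct z as [z hz]. simpl. now rewrite (k_ext_in z hz).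
Qed.

Lemma track_continuous (p : glue) (s : R) : -1 <= s <= 1 -> forall eps, 0 < eps ->
  exists d, 0 < d /\ forall (q : glue) s', -1 <= s' <= 1 -> dist p q < d ->
    Rabs (s - s') < d -> dist (track p s) (track q s') < eps.
Proof.
  intros Hs eps He. unfold track at 1.
  assert (Hpos : 0 <= s -> exists d, 0 < d /\ forall (q : glue) s', 0 <= s' <= 1 ->
    dist p q < d -> Rabs (s - s') < d -> dist (J_ext p s) (J_ext q s') < eps).
  { intros H. apply (J_ext_continuous p s); [lra | auto]. }
  assert (Hneg : s <= 0 -> exists d, 0 < d /\ forall (q : glue) s', -1 <= s' <= 0 ->
    dist p q < d -> Rabs (s - s') < d ->
    dist (k_ext (h (base p) (- s))) (k_ext (h (base q) (- s'))) < eps).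
  { intros H. destruct (push_h_continuous p (- s) ltac:(lra) eps He) as [d [Hd Hc]].
    exists d. split; auto. intros q s' Hs' Hq Hss. apply Hc; [lra | auto |].
    replace (- s - - s') with (- (s - s')) by ring. now rewrite Rabs_Ropp. }
  destruct (Rle_dec 0 s) as [H0|H0].
  - destruct (Hpos H0) as [d [Hd H]]. destruct (Rlt_or_le 0 s) as [Hs0|Hs0].
    + exists (Rmin d s). split; [now apply Rmin_glb_lt|].
      pose proof (Rmin_l d s). pose proof (Rmin_r d s).
      intros q s' Hs' Hq Hss. pose proof (Rabs_def2 _ _ Hss).
      unfold track. destruct (Rle_dec 0 s'); [|lra]. apply H; lra.
    + assert (s = 0) by lra. subst s.
      destruct (Hneg ltac:(lra)) as [d' [Hd' H']].
      exists (Rmin d d'). split; [now apply Rmin_glb_lt|].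
      pose proof (Rmin_l d d'). pose proof (Rmin_r d d').
      intros q s' Hs' Hq Hss. unfold track. destruct (Rle_dec 0 s').
      * apply H; lra.
      * rewrite track_zero. replace 0 with (- 0) by ring. apply H'; lra.
  - destruct (Hneg ltac:(lra)) as [d [Hd H]].
    exists (Rmin d (- s)). split; [apply Rmin_glb_lt; lra|].
    pose proof (Rmin_l d (- s)). pose proof (Rmin_r d (- s)).
    intros q s' Hs' Hq Hss. pose proof (Rabs_def2 _ _ Hss).
    unfold track. destruct (Rle_dec 0 s'); [lra|]. apply H; lra.
Qed.

(* The time at which [track] is run: it is [1] (the identity) for [t = 0] and [w > 0], and
   [- t] at depth [w = 0]. It is discontinuous only at [w = t = 0]. *)
Definition sigma (w t : R) : R := Rmax ((w - t) / (w + t)) (w - t).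

Lemma sigma_bounds (w t : R) : 0 <= w <= 1 -> 0 <= t <= 1 -> -1 <= sigma w t <= 1.
Proof.
  intros Hw Ht. unfold sigma. split.
  - eapply Rle_trans; [|apply Rmax_r]. lra.
  - apply Rmax_lub; [|lra].
    destruct (Req_dec (w + t) 0) as [H0|H0].
    + replace (w - t) with 0 by lra. unfold Rdiv. rewrite Rmult_0_l. lra.
    + apply Rmult_le_reg_r with (w + t); [lra|].
      unfold Rdiv. rewrite Rmult_assoc, Rinv_l; lra.
Qed.

(** For [w >= 0], a negative [sigma w t] is at least [- t], so [h] never runs for longer than
    [t]. *)
Lemma sigma_ge (w t : R) : w - t <= sigma w t.
Proof. apply Rmax_r. Qed.

Lemma sigma_continuous (w t : R) : 0 <= w -> 0 <= t -> 0 < w + t -> forall eps, 0 < eps ->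
  exists d, 0 < d /\ forall w' t', 0 <= w' -> 0 <= t' -> Rabs (w - w') < d -> Rabs (t - t') < d ->
    Rabs (sigma w t - sigma w' t') < eps.
Proof.
  intros Hw Ht Hwt eps He. set (S := w + t) in *.
  (* [S / 4] keeps the new denominator above [S / 2], so the quotients differ by at most
     [4 * d / S]; the second arguments of [Rmax] differ by at most [2 * d]. *)
  set (d := Rmin (S / 4) (Rmin (eps / 4) (eps * S / 16))).
  assert (Hd : 0 < d /\ d <= S / 4 /\ d <= eps / 4 /\ d <= eps * S / 16).
  { unfold d. pose proof (Rmin_l (S / 4) (Rmin (eps / 4) (eps * S / 16))).
    pose proof (Rmin_r (S / 4) (Rmin (eps / 4) (eps * S / 16))).
    pose proof (Rmin_l (eps / 4) (eps * S / 16)). pose proof (Rmin_r (eps / 4) (eps * S / 16)).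
    split; [repeat apply Rmin_glb_lt; nra | lra]. }
  exists d. split; [lra|]. intros w' t' Hw' Ht' Hww Htt.
  apply Rabs_def2 in Hww. apply Rabs_def2 in Htt.
  apply Rle_lt_trans with (eps / 2); [|lra]. apply Rmax_close; [|apply Rabs_le; lra].
  assert (HS' : S / 2 < w' + t') by (unfold S in *; lra).
  replace ((w - t) / (w + t) - (w' - t') / (w' + t')) with
    (2 * (w * (t' - t) + t * (w - w')) / (S * (w' + t'))) by (unfold S; field; unfold S in *; lra).
  assert (Hp : 0 < S * (w' + t')) by nra.
  assert (Hnum : Rabs (2 * (w * (t' - t) + t * (w - w'))) <= 2 * (S * d)).
  { apply Rabs_le. unfold S. split; nra. }
  unfold Rdiv. rewrite Rabs_mult, (Rabs_right (/ _)).
  2:{ apply Rle_ge. left. now apply Rinv_0_lt_compat. }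
  apply Rmult_le_reg_r with (S * (w' + t')); auto.
  rewrite Rmult_assoc, Rinv_l by lra. nra.
Qed.

Definition push (p : glue) (t : R) : glue := track p (sigma (depth p) t).

Lemma depth_bounds (p : glue) : 0 <= depth p <= 1.
Proof. split; [apply dset_nonneg | apply dset_le1]. Qed.

Lemma depth_abs (p q : glue) : Rabs (depth p - depth q) <= dist p q.
Proof.
  pose proof (depth_glue_lip p q). pose proof (depth_glue_lip q p).
  rewrite (dist_sym glue q p) in *. apply Rabs_le. lra.
Qed.

Lemma push_continuous : htpy_continuous push.
Proof.
  intros p t Ht eps He. pose proof (depth_bounds p) as Hw.
  destruct (Rlt_or_le 0 (depth p + t)) as [Hpos|Hzero].
  - destruct (track_continuous p (sigma (depth p) t) (sigma_bounds _ _ Hw Ht) eps He)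
      as [d [Hd H]].
    destruct (sigma_continuous (depth p) t ltac:(lra) ltac:(lra) Hpos d Hd) as [d' [Hd' H']].
    exists (Rmin d d'). split; [now apply Rmin_glb_lt|].
    pose proof (Rmin_l d d'). pose proof (Rmin_r d d').
    intros q t' Ht' Hq Htt. pose proof (depth_bounds q). pose proof (depth_abs p q).
    apply H; [now apply sigma_bounds | lra |]. apply H'; lra.
  - assert (t = 0) by lra. subst t.
    destruct p as [x|z]; [pose proof (depth_inl x); lra|].
    assert (Hz : push (inr z) 0 = inr z).
    { unfold push, track. pose proof (sigma_ge (depth (inr z)) 0).
      destruct (Rle_dec _ _); [reflexivity | lra]. }
    rewrite Hz.
    (* Near this point [sigma] takes values in [[- t', 1]]: the nonnegative ones are covered by the
       uniform bound on [J_ext], the negative ones by [h] at times up to [t']. *)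
    destruct (J_ext_inr z eps He) as [d [Hd H]].
    destruct (push_h_continuous (inr z) 0 ltac:(lra) eps He) as [d' [Hd' H']].
    rewrite <- track_zero in H'. simpl J_ext in H'.
    exists (Rmin d d'). split; [now apply Rmin_glb_lt|].
    pose proof (Rmin_l d d'). pose proof (Rmin_r d d').
    intros q t' Ht' Hq Htt. pose proof (depth_bounds q) as Hwq. unfold push, track.
    pose proof (sigma_bounds _ _ Hwq Ht'). pose proof (sigma_ge (depth q) t').
    pose proof (Rabs_def2 _ _ Htt).
    destruct (Rle_dec _ _).
    + apply H; lra.
    + apply H'; [lra | lra |]. apply Rabs_def1; lra.
Qed.

Lemma infinity_Zset : Zset at_infinity.
Proof.
  split; [apply at_infinity_closed|]. exists push. split; [apply push_continuous|]. split.
  - intros p. unfold push, track. pose proof (sigma_ge (depth p) 0).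
    pose proof (depth_bounds p).
    destruct (Rle_dec _ _); [|lra]. destruct p as [x|z]; auto. simpl.
    pose proof (depth_inl x).
    replace (sigma (depth (inl x)) 0) with 1; [now rewrite J1|].
    unfold sigma. rewrite Rmax_left.
    + field. lra.
    + replace ((depth (inl x) - 0) / (depth (inl x) + 0)) with 1 by (field; lra). lra.
  - intros p t Ht. unfold push, track.
    pose proof (depth_bounds p) as Hw.
    pose proof (sigma_bounds _ t Hw ltac:(lra)) as Hs.
    destruct (Rle_dec _ _) as [H0|H0].
    (* For [t > 0] a point at infinity never falls under [J_ext]: at depth [0], [sigma] is the
       maximum of [-1] and [- t]. *)
    + destruct p as [x|z]; [exact (fun h => h)|]. exfalso.
      rewrite depth_inr in H0. revert H0. unfold sigma.
      replace ((0 - t) / (0 + t)) with (-1) by (field; lra). apply Rmax_case; lra.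
    + assert (Hn : ~ Z (h (base p) (- sigma (depth p) t))) by (apply hZ; lra).
      rewrite (k_ext_out _ Hn). exact (fun h => h).
Qed.
End PushIn.
End Glue.

(** * Group actions and boundaries *)

(** If [x = a g y] with [y] in [K] and [f x] in [C], then [b g] carries a point of [f K] into [C],
    which properness allows for finitely many [g] only; so the preimage is a closed subset of
    finitely many translates of [K]. *)
Lemma preimage_compact {G : Group} {X Y : MetricSpace} (a : G -> X -> X) (b : G -> Y -> Y)
    (f : X -> Y) (C : Y -> Prop) :
  is_action a -> cocompact_action a -> proper_action b -> continuous f -> equivariant a b f ->
  compact_set C -> compact_set (fun x => C (f x)).
Proof.
  intros [_ [_ Ha]] [K [HK Hcov]] Hb Hf Heq HC.
  destruct (Hb _ (compact_union _ _ HC (compact_image f K Hf HK))) as [l Hl].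
  apply (compact_closed_subset
    (fun x => exists g, In g l /\ exists y, K y /\ a g y = x)).
  - apply (compact_list_union (fun g x => exists y, K y /\ a g y = x)).
    intros g. now apply compact_image.
  - exact (open_preimage f (compl C) Hf (compact_is_closed C HC)).
  - intros x Hx. destruct (Hcov x) as [g [y [Hy <-]]]. exists g. split; eauto.
    apply Hl. exists (f y). split; eauto. left. now rewrite <- Heq.
Qed.

Lemma AR_homeomorphism {X Y : MetricSpace} (e : X -> Y) :
  homeomorphism e -> AR X -> AR Y.
Proof.
  intros [e' [He [He' [H1 H2]]]] [Hsep HAR]. split.
  - destruct Hsep as [s Hs]. exists (fun n => e (s n)). intros y r Hr.
    destruct (He (e' y) r Hr) as [d [Hd H]]. destruct (Hs (e' y) d Hd) as [_ [[n <-] Hn]].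
    exists (e (s n)). split; eauto. rewrite <- (H2 y) at 1. auto.
  - intros W HW j [Hj [Hinj [Hinv Hcl]]].
    destruct (HAR W HW (fun x => j (e x))) as [r [Hr Hrj]].
    + split; [exact (continuous_comp e j He Hj)|]. split; [|split].
      * intros x x' Hx. apply Hinj in Hx. now rewrite <- (H1 x), Hx, H1.
      * intros x eps Heps. destruct (He' (e x) eps Heps) as [d [Hd H]].
        destruct (Hinv (e x) d Hd) as [d' [Hd' H']]. exists d'. split; auto.
        intros x' Hx. rewrite <- (H1 x), <- (H1 x'). auto.
      * intros w Hw. destruct (Hcl w) as [r [Hr H]].
        { intros [y <-]. apply Hw. exists (e' y). now rewrite H2. }
        exists r. split; auto. intros w' Hw' [x <-]. apply (H _ Hw'). eauto.
    + exists (fun w => e (r w)). split; [exact (continuous_comp r e Hr He)|].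
      intros y. rewrite <- (H2 y) at 1. rewrite Hrj. apply H2.
Qed.

Section Boundary.
Context {G : Group} {Y : MetricSpace} (Z : Y -> Prop)
  (b : G -> subspace Y (compl Z) -> subspace Y (compl Z))
  (HY : compact_space Y) (HZ : is_closed Z) (Hb : is_action b) (Hprop : proper_action b)
  (Hnull : nullity Z b).

Lemma translates_small (C : subspace Y (compl Z) -> Prop) (eps : R) :
  compact_set C -> 0 < eps ->
  exists l, forall g, ~ In g l -> forall x y, C x -> C y -> dist (b g x) (b g y) < eps.
Proof.
  intros HC He.
  destruct (Hnull C HC Y (fun c y => dist c y < eps / 2)) as [l Hl].
  - intros c. apply is_open_ball.
  - intros y. exists y. rewrite dist_refl. lra.
  - exists l. intros g Hg x y Hx Hy. destruct (Hl g Hg) as [c Hc].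
    pose proof (Hc x Hx). pose proof (Hc y Hy). simpl.
    pose proof (dist_tri Y (proj1_sig (b g x)) c (proj1_sig (b g y))).
    rewrite (dist_sym Y _ c) in *. lra.
Qed.

(** The points where [dset Z] is at least [eps] form a compact subset of the complement of [Z],
    which by properness meets only finitely many translates of [C]. *)
Lemma translates_near_boundary (C : subspace Y (compl Z) -> Prop) (eps : R) :
  compact_set C -> 0 < eps ->
  exists l, forall g, ~ In g l -> forall x, C x -> dset Z (proj1_sig (b g x)) < eps.
Proof.
  intros HC He.
  assert (HD : compact_set (fun x : subspace Y (compl Z) => eps <= dset Z (proj1_sig x))).
  { apply (compact_in_complement Z (fun y => eps <= dset Z y)); auto.
    - intros y Hy. exists (eps - dset Z y). unfold compl in *. split; [lra|].
      intros y' Hd. pose proof (dset_lip Z y' y). rewrite (dist_sym Y y' y) in *. lra.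
    - intros y Hy Hz. rewrite (dset_in Z y Hz) in Hy. lra. }
  destruct (Hprop _ (compact_union _ _ HC HD)) as [l Hl].
  exists l. intros g Hg x Hx. apply Rnot_le_lt. intros Hle. apply Hg, Hl. eauto.
Qed.

(* Nullity turns equivariance into control at infinity: near [Z] the pair [(u s, v t s)] lies in
   a translate of one fixed compact set by an element outside a finite set. *)
Lemma equivariant_control {S : MetricSpace} {T : Type} (a : G -> S -> S)
    (u : S -> subspace Y (compl Z)) (v : T -> S -> subspace Y (compl Z)) :
  cocompact_action a -> continuous u -> equivariant a b u -> (forall t, equivariant a b (v t)) ->
  (forall K, compact_set K ->
     exists C, compact_set C /\ forall s t, K s -> C (v t s)) ->
  forall eps, 0 < eps -> exists d, 0 < d /\ forall s t,
    dset Z (proj1_sig (u s)) < d -> dist (v t s) (u s) < eps.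
Proof.
  intros [K [HK Hcov]] Hu Heu Hev Hv eps He.
  destruct (Hv K HK) as [C [HC HvC]].
  pose proof (compact_image u K Hu HK) as HuK.
  destruct (translates_small _ eps (compact_union _ _ HC HuK) He) as [l Hl].
  (* The exceptional translates of [u K] form a compact set and so stay away from [Z]; [d] is their
     clearance, and a point nearer to [Z] belongs to none of them. *)
  assert (HL : compact_set (fun y => exists g, In g l /\
    exists x, (exists s, K s /\ u s = x) /\ b g x = y)).
  { apply (compact_list_union (fun g y => exists x, (exists s, K s /\ u s = x) /\ b g x = y)).
    intros g. apply compact_image; auto. apply Hb. }
  destruct (compact_uniform _ (fun (y : subspace Y (compl Z)) r => r <= dset Z (proj1_sig y)) HL)
    as [d [Hd H]].
  - intros; lra.
  - intros y _. pose proof (dset_pos Z (proj1_sig y) HZ (proj2_sig y)).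
    exists (dset Z (proj1_sig y) / 2). split; [lra|]. intros y' Hy'. simpl in Hy'.
    pose proof (dset_lip Z (proj1_sig y) (proj1_sig y')). lra.
  - exists d. split; auto. intros s t Hs. destruct (Hcov s) as [g [s0 [Hs0 <-]]].
    rewrite (Heu g s0) in Hs |- *. rewrite (Hev t g s0). apply Hl; eauto.
    intros Hg. apply Rlt_not_le in Hs. apply Hs. apply H. exists g. eauto 6.
Qed.
End Boundary.

(** * Assembling the structure on the glued space *)

Theorem theorem4p1 (G : Group)
  (X1 : MetricSpace) (a1 : G -> X1 -> X1)
  (Xh2 : MetricSpace) (Z : Xh2 -> Prop)
  (a2 : G -> subspace Xh2 (compl Z) -> subspace Xh2 (compl Z)) :
  locally_compact X1 -> AR X1 -> finite_dim X1 ->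
  is_action a1 -> proper_action a1 -> cocompact_action a1 -> free_action a1 ->
  AR (subspace Xh2 (compl Z)) ->
  is_action a2 -> proper_action a2 -> cocompact_action a2 -> free_action a2 ->
  equiv_htpy_equivalent a1 a2 ->
  AR_ZStructure Xh2 Z a2 ->
  exists (Xh1 : MetricSpace) (Z1 : Xh1 -> Prop)
         (e : X1 -> subspace Xh1 (compl Z1))
         (a1' : G -> subspace Xh1 (compl Z1) -> subspace Xh1 (compl Z1)),
    homeomorphism e /\ equivariant a1 a1' e /\
    homeomorphic (subspace Xh1 Z1) (subspace Xh2 Z) /\
    ZStructure Xh1 Z1 a1'.
Proof.
  intros _ HAR [n Hdim] Hact Hprop Hcoc Hfree _ Hact2 Hprop2 Hcoc2 _
    [f [k [Hf [Hk [Hfeq [Hkeq [[J [HJ [J0 [J1 HJeq]]]] _]]]]]]]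
    [_ [HY [HZ [_ [[_ [h [Hh [h0 hZ]]]] [_ [_ [_ [_ Hnull]]]]]]]]].
  assert (Hkctl : forall eps, 0 < eps -> exists d, 0 < d /\ forall y : subspace Xh2 (compl Z),
     dset Z (proj1_sig y) < d -> dist (f (k y)) y < eps).
  { intros eps He.
    destruct (equivariant_control Z a2 HZ Hact2 Hnull a2 (fun y => y)
      (fun (_ : unit) y => f (k y))) with (eps := eps) as [d [Hd H]]; auto.
    - intros x e Hpos. exists e. auto.
    - intros g y. reflexivity.
    - intros _ g y. now rewrite Hkeq, Hfeq.
    - intros K HK. eexists. split.
      + exact (compact_image _ K (continuous_comp k f Hk Hf) HK).
      + intros y _ Hy. exists y. auto.
    - exists d. split; auto. intros y Hy. exact (H y tt Hy). }
  assert (HJctl : forall eps, 0 < eps -> exists d, 0 < d /\ forall x t, 0 <= t <= 1 ->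
     dset Z (proj1_sig (f x)) < d -> dist (f (J x t)) (f x) < eps).
  { intros eps He.
    destruct (equivariant_control Z a2 HZ Hact2 Hnull a1 f
      (fun (t : {t | 0 <= t <= 1}) x => f (J x (proj1_sig t)))) with (eps := eps)
      as [d [Hd H]]; auto.
    - intros [t Ht] g x. simpl. now rewrite (HJeq t Ht g x), Hfeq.
    - intros K HK. destruct (compact_htpy_image J K HJ HK) as [C [HC HJC]].
      eexists. split; [exact (compact_image f C Hf HC)|].
      intros x [t Ht] Hx. exists (J x t). auto.
    - exists d. split; auto. intros x t Ht Hx. exact (H x (exist _ t Ht) Hx). }
  set (Xh1 := glue Z HZ f).
  set (Z1 := at_infinity Z HZ f).
  set (e := to_finite Z HZ f). set (e' := of_finite Z HZ f).
  assert (Hee' : forall p, e (e' p) = p) by apply to_of_finite.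
  assert (He : continuous e) by exact (to_finite_continuous Z HZ f Hf).
  assert (He' : continuous e') by exact (of_finite_continuous Z HZ f).
  assert (Hhomeo : homeomorphism e) by (exists e'; repeat split; auto).
  assert (HZset : Zset Z1).
  { exact (infinity_Zset Z HZ f k J h Hf Hk HJ Hh J0 J1 h0 hZ Hkctl HJctl). }
  assert (Hcpt : compact_space Xh1).
  { apply glue_compact; auto. intros C HC. now apply (preimage_compact a1 a2). }
  set (a1' := fun g p => e (a1 g (e' p))).
  assert (Hpull : forall C, compact_set C -> compact_set (fun x => C (e x))).
  { intros C HC I U HU Hcov. destruct (HC I (fun i p => U i (e' p))) as [l Hl].
    - intros i. now apply open_preimage.
    - intros p Hp. apply Hcov. now rewrite Hee'.
    - exists l. intros x Hx. destruct (Hl _ Hx) as [i Hi]. exists i. exact Hi. }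
  exists Xh1, Z1, e, a1'. split; [exact Hhomeo|]. split; [intros g x; reflexivity|].
  split; [apply infinity_homeomorphic|].
  split; [split|].
  - apply (AR_of_Zset Z1 Hcpt HZset). exact (AR_homeomorphism e Hhomeo HAR).
  - exists n. apply (@dim_le_approximate Xh1 X1); auto. intros eps Heps.
    destruct HZset as [_ [q [Hq [q0 qZ]]]].
    destruct (htpy_uniformly_small q Hcpt Hq q0 eps Heps) as [t [Ht Hsmall]].
    set (qt := fun p => exist (compl Z1) (q p t) (qZ p t Ht) : subspace Xh1 (compl Z1)).
    exists (fun p => e' (qt p)), (fun x => proj1_sig (e x)). split; [|split].
    + apply (continuous_comp qt e'); auto. intros p r Hr.
      destruct (Hq p t ltac:(lra) r Hr) as [d [Hd H]]. exists d. split; auto.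
      intros p' Hp. apply H; [lra | auto |]. now rewrite Rminus_diag, Rabs_R0.
    + exact (inl_continuous Z HZ f Hf).
    + intros p. rewrite Hee'. apply Hsmall.
  - split; [exact Hcpt|]. split; [apply at_infinity_closed|].
    split; [now apply Zset_dense_complement|]. split; [exact HZset|].
    destruct Hact as [Hone [Hmul Hcont]].
    split; [|split; [|split; [|split]]].
    + split; [|split].
      * intros p. unfold a1'. now rewrite Hone, Hee'.
      * intros g g' p. unfold a1'. now rewrite Hmul.
      * intros g. apply (continuous_comp (fun p => a1 g (e' p)) e); auto.
        now apply (continuous_comp e' (a1 g)).
    + intros K HK. destruct (Hprop _ (Hpull K HK)) as [l Hl]. exists l.
      intros g [p [Hp Hgp]]. apply Hl. exists (e' p). split; [now rewrite Hee' | exact Hgp].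
    + destruct Hcoc as [K [HK Hcov]].
      exists (fun p => exists x, K x /\ e x = p). split; [now apply compact_image|].
      intros p. destruct (Hcov (e' p)) as [g [x [Hx Hgx]]].
      exists g, (e x). split; eauto. unfold a1'.
      change (e (a1 g x) = p). rewrite Hgx. apply Hee'.
    + intros g p Hg. apply (Hfree g (e' p)). exact (f_equal e' Hg).
    + intros C HC I U HU Hcov.
      destruct (lebesgue_number U Hcpt HU Hcov) as [lam [Hlam HL]].
      pose proof (compact_image f _ Hf (Hpull C HC)) as HfC.
      (* Translates of [C] are measured through [f]: the distance of the bases and the two depths in
         [glue_dist_le] are each below [lam / 4]. *)
      destruct (translates_small Z a2 Hnull _ (lam / 4) HfC ltac:(lra)) as [l1 H1].
      destruct (translates_near_boundary Z a2 HY HZ Hprop2 _ (lam / 4) HfC ltac:(lra))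
        as [l2 H2].
      exists (l1 ++ l2). intros g Hg.
      assert (Hg1 : ~ In g l1) by (intros Hin; apply Hg, in_or_app; auto).
      assert (Hg2 : ~ In g l2) by (intros Hin; apply Hg, in_or_app; auto).
      (* Nullity asks for an index even when [C] is empty; separability of [X1] supplies a point,
         and the cover an index there. *)
      destruct (classic (exists p, C p)) as [[p Hp]|Hempty].
      2:{ destruct HAR as [[s _] _]. destruct (HL (proj1_sig (e (s O)))) as [i _].
          exists i. intros p Hp. exfalso. eauto. }
      destruct (HL (proj1_sig (a1' g p))) as [i Hi]. exists i. intros p' Hp'. apply Hi.
      assert (Hf1 : forall q, C q -> exists x, C (e x) /\ f x = f (e' q)).
      { intros q Hq. exists (e' q). now rewrite Hee'. }
      pose proof (H1 g Hg1 _ _ (Hf1 p Hp) (Hf1 p' Hp')) as Hd.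
      pose proof (H2 g Hg2 _ (Hf1 p Hp)) as Hw. pose proof (H2 g Hg2 _ (Hf1 p' Hp')) as Hw'.
      rewrite <- (Hfeq g (e' p)) in Hd, Hw. rewrite <- (Hfeq g (e' p')) in Hd, Hw'.
      eapply Rle_lt_trans; [apply glue_dist_le|].
      set (y := proj1_sig (f (a1 g (e' p)))) in *.
      set (y' := proj1_sig (f (a1 g (e' p')))) in *.
      change (dist y y' < lam / 4) in Hd.
      change (dist y y' + dset Z y + dset Z y' < lam). lra.
Qed.
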